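(* Fix $(\mu,\nu)\in\boldsymbol{\mathcal P}$. For every boundary datum $\varphi\in C([0,1],\mathcal P([0,1]))$ the following problem has a solution, and this solution is unique: find a continuous map $G:\mathbb S\to\mathcal P([0,1])$ such that for all $(x,y)\in\mathbb S$ $$x\int_0^\beta \big(G(x,y)-G(x+k,y)\big)\mu(dk)+y\int_0^\beta\big(G(x,y)-G(x,y+k)\big)\nu(dk)=0,$$ $G(0,y)=\varphi(0)$ for $y>0$, $G(x,0)=\varphi(1)$ for $x>0$, and $d_W\big(G(x,y),\varphi(\tfrac{x}{x+y})\big)\to 0$ as $x+y\to\infty$. Moreover, the solution depends continuously on the boundary datum: denoting the solution by $G^\varphi_{(\mu,\nu)}$, the map $\varphi\mapsto G^\varphi_{(\mu,\nu)}$ is continuous from $(C([0,1],\mathcal P([0,1])),d_\infty)$ to $(C(\mathbb S,\mathcal P([0,1])),d)$.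
   Context: $\mathcal P([0,\beta])$ denotes the set of Borel probability measures on $[0,\beta]$, endowed with the 1-Wasserstein metric $d_W(\xi_1,\xi_2)=\int_0^\beta|F_{\xi_1}(t)-F_{\xi_2}(t)|\,dt$ ($F_\xi$ the distribution function). Fix constants $0<m_0\le\beta<\infty$. $\boldsymbol{\mathcal P}$ is the set of pairs $(\mu,\nu)$ of probability measures on $[0,\beta]$ with $\int_0^\beta k\,\mu(dk)=\int_0^\beta k\,\nu(dk)\ge m_0$. $\mathbb S=[0,\infty)\times[0,\infty)\setminus\{(0,0)\}$. A boundary datum is a continuous map $\varphi:[0,1]\to(\mathcal P([0,1]),d_W)$; on such maps $d_\infty(\varphi_1,\varphi_2)=\sup_{t\in[0,1]}d_W(\varphi_1(t),\varphi_2(t))$. The functional equation is an identity between finite signed measures on $[0,1]$ (integrals of measure-valued maps taken setwise). $C(\mathbb S,\mathcal P([0,1]))$ is the set of continuous maps $\mathbb S\to(\mathcal P([0,1]),d_W)$, with metric $d(G_1,G_2)=\sum_{n\ge1}2^{-n}\frac{d_n(G_1,G_2)}{1+d_n(G_1,G_2)}$, where $d_n(G_1,G_2)=\sup\{d_W(G_1(x,y),G_2(x,y)):(x,y)\in\mathbb S,\ x+y\ge 1/n\}$. *)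

(* Defs.v *)
From HB Require Import structures.
From mathcomp Require Import all_boot all_order all_algebra.
From mathcomp Require Import all_classical all_reals all_analysis.
Set Implicit Arguments. Unset Strict Implicit. Unset Printing Implicit Defensive.
Import Order.TTheory GRing.Theory Num.Theory.
Import numFieldNormedType.Exports.
Local Open Scope classical_set_scope.
Local Open Scope ring_scope.

(* Probability measures on R (Borel sets); "a measure on [0,b]" is a
   probability measure on R concentrated on [0,b]. *)
Notation prob R := (probability R R).

Definition supp_in {R : realType} (b : R) (P : prob R) : Prop :=
  P `[0, b]%classic = 1%E.

Definition meq {R : realType} (P Q : prob R) : Prop :=
  forall A : set R, measurable A -> P A = Q A.

Definition distF {R : realType} (P : prob R) (t : R) : R :=
  fine (P `]-oo, t]%classic).

(* 1-Wasserstein distance on P([0,b]) : int_0^b |F_P - F_Q| dt *)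
Definition dW {R : realType} (b : R) (P Q : prob R) : R :=
  (\int[lebesgue_measure]_(t in `[0, b]%classic) `|distF P t - distF Q t|)%R.

Definition inS {R : realType} (x y : R) : Prop :=
  0 <= x /\ 0 <= y /\ (x, y) <> (0, 0).

Definition boundary_datum {R : realType} (phi : R -> prob R) : Prop :=
  (forall t, 0 <= t <= 1 -> supp_in 1 (phi t)) /\
  (forall t, 0 <= t <= 1 -> forall e : R, 0 < e -> exists2 d : R, 0 < d &
     forall s, 0 <= s <= 1 -> `|s - t| < d -> dW 1 (phi s) (phi t) < e).

Definition d_infty {R : realType} (phi1 phi2 : R -> prob R) : R :=
  sup [set r | exists t, 0 <= t <= 1 /\ r = dW 1 (phi1 t) (phi2 t)].

Definition contS {R : realType} (G : R -> R -> prob R) : Prop :=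
  (forall x y, inS x y -> supp_in 1 (G x y)) /\
  (forall x y, inS x y -> forall e : R, 0 < e -> exists2 d : R, 0 < d &
     forall x' y', inS x' y' -> `|x' - x| < d -> `|y' - y| < d ->
       dW 1 (G x' y') (G x y) < e).

Definition d_n {R : realType} (n : nat) (G1 G2 : R -> R -> prob R) : R :=
  sup [set r | exists x y, inS x y /\ n%:R^-1 <= x + y /\
                           r = dW 1 (G1 x y) (G2 x y)].

Definition dC {R : realType} (G1 G2 : R -> R -> prob R) : R :=
  limn (fun N => \sum_(1 <= n < N)
          (2%:R ^- n * (d_n n G1 G2 / (1 + d_n n G1 G2)))).

Definition solves {R : realType} (beta : R) (mu nu : prob R)
  (phi : R -> prob R) (G : R -> R -> prob R) : Prop :=
  contS G /\
  (forall x y, inS x y -> forall A : set R, measurable A -> A `<=` `[0, 1]%classic ->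
     ((x%:E * \int[mu]_(k in `[0%R, beta]%classic) (G x y A - G (x + k)%R y A)) +
      (y%:E * \int[nu]_(k in `[0%R, beta]%classic) (G x y A - G x (y + k)%R A)) = 0)%E) /\
  (forall y, 0 < y -> meq (G 0 y) (phi 0)) /\
  (forall x, 0 < x -> meq (G x 0) (phi 1)) /\
  (forall e : R, 0 < e -> exists M : R, forall x y, inS x y -> M <= x + y ->
     dW 1 (G x y) (phi (x / (x + y))) < e).

(* Main.v *)
Require Import Defs.
From HB Require Import structures.
From mathcomp Require Import all_boot all_order all_algebra.
From mathcomp Require Import all_classical all_reals all_analysis.
From mathcomp Require Import measurable_realfun ring lra.
Set Implicit Arguments. Unset Strict Implicit. Unset Printing Implicit Defensive.
Import Order.TTheory GRing.Theory Num.Theory.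
Import numFieldNormedType.Exports.
Local Open Scope classical_set_scope.
Local Open Scope ring_scope.

(* For a probability P on [0,1] put intF P t = int_0^t F_P.  Distribution
   functions are the right derivatives of these convex functions, and d_W is
   controlled by the values of intF at finitely many t, so the equation splits
   into scalar ones: for each t, g(x,y) = intF (G x y) t is invariant under
   averaging over one step of a two-colour randomly reinforced urn.
   Uniqueness and continuity come from a maximum principle: with s = x + y,
   exp(-s) is multiplied by at most some rho < 1 under averaging, so an
   invariant bounded function is controlled by its values at infinity.
   For existence, iterate the averaging operator T on f(x/(x+y)).  The means of
   mu and nu agree, so (x/s - z0)^2 + K/(s + beta) is superharmonic; hence
   T^n f - f <= eps + B exp(-s) uniformly in n, and the decay of exp(-s) makes
   T^n f uniformly Cauchy.  The maximum principle makes the limits convex in t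
   with the right slopes, so they are intF of probability measures. *)

(** * Distribution functions and their integrals *)

(** The obstacle is that convergence in [dW] says nothing about [distF] at a fixed [t] where it
    jumps, so [distF (G x y) t] need not be continuous in [(x, y)]. Its integral [intF] is
    1-Lipschitz for [dW] at every [t]: each scalar problem then has bounded continuous data and
    solutions, and measurability of [distF] and of [G x y A] in the increment is recovered by
    limits. Both comparison functions are estimated by majorants affine in the increment [k], so
    that [mu] and [nu] enter only through their mean [m]; positivity of [m] gives the strict
    contraction of the exponential. The passage back to measures rests on a description of the
    functions [intF P] by linear relations among at most three of their values. Such relations hold
    for the datum and are transported by the maximum principle, so no compactness of the space of
    measures is involved. *)

Section DistributionFunctions.
Context {R : realType}.
Implicit Types (P Q : prob R).

Lemma EFin_distF P t : (distF P t)%:E = P `]-oo, t]%classic.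
Proof. by rewrite fineK// fin_num_measure. Qed.

Lemma distF_ge0 P t : 0 <= distF P t.
Proof. by rewrite fine_ge0. Qed.

Lemma distF_le1 P t : distF P t <= 1.
Proof. by rewrite -lee_fin EFin_distF probability_le1. Qed.

Lemma distF_nd P : {homo distF P : s t / s <= t}.
Proof.
move=> s t st; rewrite -lee_fin !EFin_distF le_measure ?inE//.
exact: subitvPr.
Qed.

Lemma measurable_distF P (D : set R) :
  measurable D -> measurable_fun D (distF P).
Proof. by move=> mD; apply: nondecreasing_measurable => //; exact: distF_nd. Qed.

Lemma distF_right P t : (fun n => distF P (t + n.+1%:R^-1)) @ \oo --> distF P t.
Proof.
apply: fine_cvg; rewrite fineK ?fin_num_measure// (itvNycEbigcap false).
apply: nonincreasing_cvg_mu => //.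
- by rewrite -ge0_fin_numE// fin_num_measure.
- exact: bigcap_measurable.
- move=> m n mn; apply/subsetPset; apply: subset_itvl.
  by rewrite bnd_simp lerD2l lef_pV2 ?posrE// ler_nat.
Qed.

Lemma supp_in_setI (b : R) P A : supp_in b P -> measurable A ->
  P A = P (A `&` `[0, b]%classic).
Proof.
move=> sP mA; have mI : measurable (`[0, b]%classic : set R) by [].
have PC : P (~` `[0, b]%classic) = 0%E.
  by rewrite probability_setC// sP subee.
rewrite -[in LHS](setIT A) -(setUv `[0, b]%classic) setIUr measureU//=.
- rewrite [X in (_ + X)%E](_ : _ = 0%E) ?adde0//.
  apply/eqP; rewrite eq_le measure_ge0 andbT -PC.
  by apply: le_measure; rewrite ?inE//; [apply: measurableI => //; exact: measurableC
    | exact: measurableC].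
- exact: measurableI.
- by apply: measurableI => //; exact: measurableC.
- by rewrite setIACA setICr setI0.
Qed.

Lemma supp_distF_lt0 P t : supp_in 1 P -> t < 0 -> distF P t = 0.
Proof.
move=> sP t0; rewrite /distF (supp_in_setI sP)// [X in P X](_ : _ = set0).
  by rewrite measure0.
apply/seteqP; split => x //= []; rewrite !in_itv/= => xt /andP[x0 _].
by have := le_lt_trans x0 (le_lt_trans xt t0); rewrite ltxx.
Qed.

Lemma supp_distF_ge1 P t : supp_in 1 P -> 1 <= t -> distF P t = 1.
Proof.
move=> sP t1; rewrite /distF (supp_in_setI sP)// setIidr.
  by rewrite [X in fine X]sP.
by move=> x /=; rewrite !in_itv/= => /andP[_ /le_trans]; apply.
Qed.

Lemma distF_supp P : (forall t, t < 0 -> distF P t = 0) -> distF P 1 = 1 ->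
  supp_in 1 P.
Proof.
(* The open half-line is the union of the closed ones ending at [-1/(n+1)], each null by [P0]. *)
move=> P0 P1; have PI0 : P `]-oo, 0[%classic = 0%E.
  apply/negligibleP => //; rewrite -setCitvr itvcyEbigcap setC_bigcap.
  apply: negligible_bigcup => n; rewrite setCitvr; apply/negligibleP => //.
  apply: etrans (esym (EFin_distF _ _)) _.
  by rewrite P0// sub0r oppr_lt0 invr_gt0.
have E : `[0, 1]%classic = `]-oo, 1]%classic `\` `]-oo, 0[%classic :> set R.
  apply/seteqP; split => x /=; rewrite !in_itv/=.
    by move=> /andP[x0 ->]; split => //; apply/negP; rewrite -leNgt.
  by move=> [->] /negP; rewrite -leNgt => ->.
rewrite /supp_in E measureD//; last first.
  by rewrite -ge0_fin_numE// fin_num_measure.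
rewrite [X in (_ - X)%E](_ : _ = 0%E).
  by rewrite sube0; apply: etrans (esym (EFin_distF _ _)) _; rewrite P1.
apply/eqP; rewrite eq_le measure_ge0 andbT -[leRHS]PI0.
by apply: le_measure; rewrite ?inE//; exact: measurableI.
Qed.

(** Open right half-lines serve as the pi-system of both Dynkin arguments, in [distF_meq] and in
    [harmonic_measure], because their complements are the sets that [distF] measures. *)
Lemma generated_itvoy : @measurable _ R = <<s [set A | exists x : R, A = `]x, +oo[%classic] >>.
Proof. exact: RGenOInfty.measurableE. Qed.

Lemma itvoy_setI_closed : setI_closed [set A | exists x : R, A = `]x, +oo[%classic].
Proof.
move=> _ _ [a ->] [b ->]; exists (Num.max a b).
by apply/seteqP; split => x /=; rewrite !in_itv/= !andbT gt_max; [move=> [-> ->]|move/andP].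
Qed.

Lemma distF_meq P Q : distF P =1 distF Q -> meq P Q.
Proof.
move=> PQ A mA; have := mA; rewrite generated_itvoy => sA.
apply: (@dynkin_induction _ _ _ (fun A => P A = Q A) generated_itvoy
  itvoy_setI_closed _ _ _ _ _ sA).
- by rewrite !probability_setT.
- move=> _ [x ->]; have C Q' : Q' `]x, +oo[%classic = (1 - (distF Q' x)%:E)%E.
    by rewrite EFin_distF -probability_setC// setCitvl.
  by apply: etrans (C _) _; rewrite PQ -C.
- by move=> S mS PS; rewrite !probability_setC// PS.
- move=> F mF tF PF; rewrite !measure_bigcup//; apply: eq_eseriesr => n _; exact: PF.
Qed.

End DistributionFunctions.

Section IntegratedDistribution.
Context {R : realType}.
Implicit Types (P Q : prob R).

Lemma integrable_itvcc (f : R -> R) (a b C : R) :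
  measurable_fun `[a, b]%classic f ->
  (forall x, a <= x <= b -> `|f x| <= C) ->
  lebesgue_measure.-integrable `[a, b]%classic (EFin \o f).
Proof.
move=> mf fC; apply: measurable_bounded_integrable => //.
  by rewrite /= lebesgue_measure_itv/=; case: ifPn => _; rewrite ?ltry// -EFinB ltry.
exists C; split; first exact: num_real.
by move=> r Cr x /=; rewrite in_itv/= => /fC /le_trans; apply; exact: ltW.
Qed.

Definition intF P t := \int[lebesgue_measure]_(s in `[0, t]%classic) distF P s.

Lemma integrable_distF P (a b : R) :
  lebesgue_measure.-integrable `[a, b]%classic (EFin \o distF P).
Proof.
apply: (integrable_itvcc (C := 1)); first exact: measurable_distF.
by move=> x _; rewrite ger0_norm ?distF_ge0 ?distF_le1.
Qed.

Lemma Rintegral_itvcc_cst (a b c : R) : a <= b ->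
  \int[lebesgue_measure]_(s in `[a, b]%classic) c = c * (b - a).
Proof.
move=> ab; rewrite Rintegral_cst//= lebesgue_measure_itv/= lte_fin.
by case: ltP => // ba; rewrite (le_anti (introT andP (conj ab ba))) subrr.
Qed.

Lemma Rintegral_itvcc_le (f : R -> R) (a b c : R) : a <= b ->
  lebesgue_measure.-integrable `[a, b]%classic (EFin \o f) ->
  (forall x, a <= x <= b -> f x <= c) ->
  \int[lebesgue_measure]_(s in `[a, b]%classic) f s <= c * (b - a).
Proof.
move=> ab If fc; rewrite -Rintegral_itvcc_cst//; apply: le_Rintegral => //.
by apply: (integrable_itvcc (C := `|c|)) => //; exact: measurable_cst.
Qed.

Lemma Rintegral_itvcc_ge (f : R -> R) (a b c : R) : a <= b ->
  lebesgue_measure.-integrable `[a, b]%classic (EFin \o f) ->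
  (forall x, a <= x <= b -> c <= f x) ->
  c * (b - a) <= \int[lebesgue_measure]_(s in `[a, b]%classic) f s.
Proof.
move=> ab If fc; rewrite -Rintegral_itvcc_cst//; apply: le_Rintegral => //.
by apply: (integrable_itvcc (C := `|c|)) => //; exact: measurable_cst.
Qed.

Lemma Rintegral_itvcc_split (f : R -> R) (a b c : R) : a <= b -> b <= c ->
  lebesgue_measure.-integrable `[a, c]%classic (EFin \o f) ->
  \int[lebesgue_measure]_(s in `[a, c]%classic) f s =
  \int[lebesgue_measure]_(s in `[a, b]%classic) f s +
  \int[lebesgue_measure]_(s in `[b, c]%classic) f s.
Proof.
move=> ab bc If; rewrite -[in X in _ + X]Rintegral_itv_obnd_cbnd; last first.
  by apply: integrableS If => //; apply: subset_itvr; rewrite bnd_simp.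
by rewrite -(Rintegral_itvB If) ?bnd_simp// addrC subrK.
Qed.

Lemma intF_le0 P t : t <= 0 -> intF P t = 0.
Proof.
move=> t0; apply/eqP; rewrite eq_le Rintegral_ge0 ?andbT; last first.
  by move=> x _; exact: distF_ge0.
have [->|tn0] := eqVneq t 0; first by rewrite /intF set_itv1 Rintegral_set1.
by rewrite /intF set_itv_ge ?Rintegral_set0// bnd_simp -ltNge lt_neqAle tn0.
Qed.

(** The nondecreasing [distF] lies between its end values on [[t, t + h]]. For [t < 0] the
    integration interval of [intF] is empty and the support condition makes [distF] vanish there
    too, so the bounds extend to every real [t]. Convexity, slopes and the recovery of [distF] from
    [intF] all come from here. *)
Lemma intF_sandwich P t h : supp_in 1 P -> 0 <= h ->
  distF P t * h <= intF P (t + h) - intF P t <= distF P (t + h) * h.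
Proof.
move=> sP h0.
have main s u : 0 <= s -> s <= u ->
    distF P s * (u - s) <= intF P u - intF P s <= distF P u * (u - s).
  move=> s0 su; rewrite /intF (@Rintegral_itvcc_split _ 0 s u)//; last first.
    exact: integrable_distF.
  rewrite addrAC subrr add0r Rintegral_itvcc_le ?Rintegral_itvcc_ge//;
    try exact: integrable_distF; by move=> x /andP[sx xu]; apply: distF_nd.
have [t0|t0] := leP 0 t.
  by have := main t (t + h) t0; rewrite lerDl addrAC subrr add0r; apply.
rewrite (supp_distF_lt0 sP t0) mul0r (intF_le0 _ (ltW t0)) subr0.
have [th0|th0] := leP (t + h) 0.
  by rewrite intF_le0// lexx mulr_ge0 ?distF_ge0.
have /andP[m1 m2] := main 0 (t + h) (lexx _) (ltW th0).
rewrite (intF_le0 _ (lexx 0)) !subr0 in m1 m2.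
apply/andP; split.
  by apply: le_trans m1; rewrite mulr_ge0 ?distF_ge0 ?ltW.
apply: le_trans m2 _; rewrite ler_wpM2l ?distF_ge0//; lra.
Qed.

(* On a cell both distribution functions differ from the difference quotients of
   [intF] by at most their own increments, which telescope over a mesh. *)
Lemma dW_cell P Q (a h : R) : supp_in 1 P -> supp_in 1 Q -> 0 < h ->
  \int[lebesgue_measure]_(s in `[a, a + h]%classic) `|distF P s - distF Q s| <=
  `|(intF P (a + h) - intF P a) - (intF Q (a + h) - intF Q a)|
  + h * ((distF P (a + h) - distF P a) + (distF Q (a + h) - distF Q a)).
Proof.
move=> sP sQ h0.
have /andP[p1 p2] := intF_sandwich a sP (ltW h0).
have /andP[q1 q2] := intF_sandwich a sQ (ltW h0).
set D := `|_|.
have Dh : D / h * h = D by rewrite divfK ?gt_eqF.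
have mPQ : measurable_fun `[a, (a + h)]%classic (fun s => `|distF P s - distF Q s|).
  apply: measurableT_comp => //; apply: measurable_funB;
  exact: measurable_distF.
apply: (@le_trans _ _ ((D / h + ((distF P (a + h) - distF P a)
    + (distF Q (a + h) - distF Q a))) * ((a + h) - a))); last first.
  by rewrite (addrAC a) subrr add0r mulrDl Dh [h * _]mulrC.
apply: Rintegral_itvcc_le; first by rewrite lerDl ltW.
  apply: (integrable_itvcc (C := 2)) => // x _.
  rewrite normr_id (le_trans (ler_normB _ _))//.
  by rewrite !ger0_norm ?distF_ge0// (_ : 2 = 1 + 1 :> R)// lerD ?distF_le1.
move=> x /andP[ax xh].
have Pa := distF_nd P ax; have Pb := distF_nd P xh.
have Qa := distF_nd Q ax; have Qb := distF_nd Q xh.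
have := ler_norm ((intF P (a + h) - intF P a) - (intF Q (a + h) - intF Q a)).
have := lerNnormlW (lexx `|(intF P (a + h) - intF P a) - (intF Q (a + h) - intF Q a)|).
rewrite -/D => D1 D2.
have M u v : u <= v -> u * h <= v * h by move=> uv; rewrite ler_wpM2r // ltW.
have {Pa Pb Qa Qb} [Pa Pb Qa Qb] := And4 (M _ _ Pa) (M _ _ Pb) (M _ _ Qa) (M _ _ Qb).
by rewrite ler_norml; apply/andP; split; rewrite -(ler_pM2r h0) ?mulNr !mulrDl Dh; lra.
Qed.

End IntegratedDistribution.

Section WassersteinAndIntegrals.
Context {R : realType}.
Implicit Types (P Q : prob R).

Lemma integrable_distFB P Q (a b : R) : lebesgue_measure.-integrable `[a, b]%classic
  (EFin \o (fun s => `|distF P s - distF Q s|)).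
Proof.
apply: (integrable_itvcc (C := 2)).
  apply: measurableT_comp => //; apply: measurable_funB; exact: measurable_distF.
move=> x _; rewrite normr_id (le_trans (ler_normB _ _))//.
by rewrite !ger0_norm ?distF_ge0// (_ : 2 = 1 + 1 :> R)// lerD ?distF_le1.
Qed.

Lemma dW_ge0 b P Q : 0 <= dW b P Q.
Proof. by apply: Rintegral_ge0 => x _; exact: normr_ge0. Qed.

Lemma dW_le1 P Q : dW 1 P Q <= 1.
Proof.
rewrite -[leRHS](_ : 1 * (1 - 0) = 1); last by rewrite subr0 mulr1.
apply: Rintegral_itvcc_le => //; first exact: integrable_distFB.
move=> x _; rewrite ler_norml.
have := distF_ge0 P x; have := distF_le1 P x.
have := distF_ge0 Q x; have := distF_le1 Q x; lra.
Qed.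

Lemma intF_ge1 P t : supp_in 1 P -> 1 <= t -> intF P t = intF P 1 + (t - 1).
Proof.
move=> sP t1; have t10 : 0 <= t - 1 by rewrite subr_ge0.
have := intF_sandwich 1 sP t10.
rewrite (_ : 1 + (t - 1) = t); last by ring.
by rewrite !(supp_distF_ge1 sP)//; lra.
Qed.

Lemma intF_dist P Q t : supp_in 1 P -> supp_in 1 Q ->
  `|intF P t - intF Q t| <= dW 1 P Q.
Proof.
(* Past 1 both integrals have slope 1, so their difference keeps its value at 1. *)
move=> sP sQ; wlog t1 : t / t <= 1 => [H|].
  have [t1|/ltW t1] := leP t 1; first exact: H.
  rewrite (intF_ge1 sP t1) (intF_ge1 sQ t1) opprD addrACA subrr addr0.
  exact: H.
have [t0|/ltW t0] := leP t 0.
  by rewrite !intF_le0// subrr normr0 dW_ge0.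
rewrite /intF -RintegralB//; try exact: integrable_distF.
apply: (@le_trans _ _ (\int[lebesgue_measure]_(s in `[0, t]%classic) `|distF P s - distF Q s|)).
  apply: le_normr_Rintegral => //.
  apply: (@integrable_itvcc _ _ _ _ 2).
    by apply: measurable_funB; exact: measurable_distF.
  move=> x _; rewrite (le_trans (ler_normB _ _))//.
  by rewrite !ger0_norm ?distF_ge0// (_ : 2 = 1 + 1 :> R)// lerD ?distF_le1.
rewrite /dW (@Rintegral_itvcc_split _ _ 0 t 1)//; last exact: integrable_distFB.
by rewrite lerDl Rintegral_ge0.
Qed.

Lemma dW_le_mesh P Q n : supp_in 1 P -> supp_in 1 Q ->
  dW 1 P Q <= 2 / n.+1%:R + \sum_(i < n.+1)
    `|(intF P (i.+1%:R / n.+1%:R) - intF P (i%:R / n.+1%:R))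
      - (intF Q (i.+1%:R / n.+1%:R) - intF Q (i%:R / n.+1%:R))|.
Proof.
move=> sP sQ; set h := n.+1%:R^-1; have h0 : 0 < h by rewrite invr_gt0.
have aux k : \int[lebesgue_measure]_(s in `[0, k%:R * h]%classic) `|distF P s - distF Q s|
    <= h * ((distF P (k%:R * h) - distF P 0) + (distF Q (k%:R * h) - distF Q 0))
    + \sum_(i < k) `|(intF P (i.+1%:R * h) - intF P (i%:R * h))
      - (intF Q (i.+1%:R * h) - intF Q (i%:R * h))|.
  elim: k => [|k IHk].
    by rewrite !mul0r set_itv1 Rintegral_set1 big_ord0 !subrr !addr0 mulr0.
  have E : k.+1%:R * h = k%:R * h + h by rewrite -natr1 mulrDl mul1r.
  have kh0 : 0 <= k%:R * h by rewrite mulr_ge0 // ltW.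
  have kh1 : k%:R * h <= k.+1%:R * h by rewrite E lerDl ltW.
  rewrite (Rintegral_itvcc_split kh0 kh1); last exact: integrable_distFB.
  rewrite big_ord_recr/= E.
  have := dW_cell (k%:R * h) sP sQ h0; lra.
have := aux n.+1; rewrite divff// => /le_trans; apply; rewrite lerD2r.
rewrite mulrC ler_pM2r//.
have := distF_ge0 P 0; have := distF_le1 P 1.
have := distF_ge0 Q 0; have := distF_le1 Q 1; lra.
Qed.

(** Bridge from scalar estimates to [dW]: the list and the tolerance depend on [e] alone, so
    convergence of [intF] at each fixed [t] gives convergence in [dW]. *)
Lemma dW_small (e : R) : 0 < e -> exists ts : seq R, exists2 d, 0 < d &
  forall P Q, supp_in 1 P -> supp_in 1 Q ->
  (forall t, t \in ts -> `|intF P t - intF Q t| <= d) -> dW 1 P Q < e.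
Proof.
(* Since [n + 1 > 4 / e], the mesh error [2 / (n + 1)] is below [e / 2]. Each of the [n + 1] cells
   adds at most twice the tolerance [e / 8 / (n + 1)], in total [e / 4]. *)
move=> e0; pose n := Num.truncn (4 / e).
have n0 : 0 < n.+1%:R :> R by [].
have ne : 2 / n.+1%:R < e / 2.
  have h : 4 / e < n.+1%:R by rewrite truncnS_gt.
  rewrite ltr_pdivrMr// in h; rewrite ltr_pdivrMr//; lra.
exists [seq i%:R / n.+1%:R | i <- iota 0 n.+2]; exists (e / 8 / n.+1%:R).
  by rewrite !divr_gt0.
move=> P Q sP sQ H; apply: le_lt_trans (dW_le_mesh n sP sQ) _.
have Hi i : (i <= n.+1)%N ->
    `|intF P (i%:R / n.+1%:R) - intF Q (i%:R / n.+1%:R)| <= e / 8 / n.+1%:R.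
  by move=> ni; apply: H; apply/mapP; exists i => //; rewrite mem_iota.
apply: (@le_lt_trans _ _ (2 / n.+1%:R + \sum_(i < n.+1) (e / 4 / n.+1%:R))).
  rewrite lerD2l; apply: ler_sum => i _.
  rewrite opprD addrACA [X in `|_ + X|](_ : _ = - (intF P (i%:R / n.+1%:R)
    - intF Q (i%:R / n.+1%:R))); last by ring.
  rewrite (le_trans (ler_normB _ _))//.
  rewrite (_ : e / 4 = e / 8 + e / 8); last lra.
  by rewrite mulrDl lerD// Hi// ltnW.
rewrite sumr_const card_ord -(mulr_natr (e / 4 / n.+1%:R)) divfK ?gt_eqF//.
by move: ne; set r := 2 / _; lra.
Qed.

(** [distF P t] is at most the common difference quotient of [intF] on [[t, t + h]], which is at
    most [distF Q (t + h)]; right continuity removes [h]. *)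
Lemma le_distF_intF P Q : supp_in 1 P -> supp_in 1 Q ->
  (forall t, intF P t = intF Q t) -> forall t, distF P t <= distF Q t.
Proof.
move=> sP sQ PQ t.
apply: (cvgr_to_ge (@distF_right _ Q t)).
near=> n; have n0 : 0 < n.+1%:R^-1 :> R by rewrite invr_gt0.
have /andP[h1 _] := intF_sandwich t sP (ltW n0).
have /andP[_ h2] := intF_sandwich t sQ (ltW n0).
by rewrite -!PQ in h2; rewrite -(ler_pM2r n0) (le_trans h1).
Unshelve. all: by end_near. Qed.

Lemma intF_meq P Q : supp_in 1 P -> supp_in 1 Q ->
  (forall t, intF P t = intF Q t) -> meq P Q.
Proof.
move=> sP sQ PQ; apply: distF_meq => t.
by apply/eqP; rewrite eq_le !le_distF_intF.
Qed.

(** The value [distF P b] separates the chord slopes on the two sides of [b]. Products instead of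
    quotients keep the relation linear in [intF]. *)
Lemma intF_convex P a b c : supp_in 1 P -> a <= b -> b <= c ->
  (intF P b - intF P a) * (c - b) <= (intF P c - intF P b) * (b - a).
Proof.
move=> sP ab bc; have ba0 : 0 <= b - a by rewrite subr_ge0.
have cb0 : 0 <= c - b by rewrite subr_ge0.
have /andP[_] := intF_sandwich a sP ba0; rewrite subrKC => h1.
have /andP[] := intF_sandwich b sP cb0; rewrite subrKC => h2 _.
apply: (@le_trans _ _ (distF P b * (b - a) * (c - b))).
  by rewrite ler_wpM2r.
by rewrite mulrAC ler_wpM2r.
Qed.

Lemma intF_slope P a b : supp_in 1 P -> a <= b ->
  0 <= intF P b - intF P a <= b - a.
Proof.
move=> sP ab; have ba0 : 0 <= b - a by rewrite subr_ge0.
have := intF_sandwich a sP ba0; rewrite subrKC => /andP[h1 h2].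
rewrite (le_trans _ h1) ?mulr_ge0 ?distF_ge0//= (le_trans h2)//.
by rewrite ler_piMl// distF_le1.
Qed.

End WassersteinAndIntegrals.

Section ProbabilityFromIntegral.
Context {R : realType}.

(** The Lebesgue-Stieltjes measure is built on [measurableTypeR R]; its image under this identity is
    a [prob R]. *)
Let idR : measurableTypeR R -> R := idfun.

#[local] HB.instance Definition _ :=
  @isMeasurableFun.Build _ _ _ _ idR (@measurable_id _ _ setT).

Lemma cumulative_prob (F : cumulativeBounded (0 : R) (1 : R)) :
  exists P : prob R, forall t, distF P t = F t.
Proof.
pose lsF := lebesgue_stieltjes_measure F : probability (measurableTypeR R) R.
exists (distribution lsF (idR : {RV lsF >-> R})) => t.
by rewrite /distF -[RHS]/(fine (F t)%:E) -cdf_lebesgue_stieltjes_id.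
Qed.

(** The right derivative of the convex function [g] is the required distribution function. *)
Lemma intF_surjective (g : R -> R) :
  (forall t, t <= 0 -> g t = 0) ->
  (forall t, 1 <= t -> g t = g 1 + (t - 1)) ->
  (forall a b c, a <= b -> b <= c ->
     (g b - g a) * (c - b) <= (g c - g b) * (b - a)) ->
  (forall a b, a <= b -> 0 <= g b - g a <= b - a) ->
  exists P : prob R, supp_in 1 P /\ forall t, intF P t = g t.
Proof.
move=> g0 g1 gconv gslope.
pose S t h := (g (t + h) - g t) / h.
(* By convexity [S t h] decreases as [h] decreases to 0, so the infimum is the right derivative. *)
pose F t := inf [set S t h | h in [set h | 0 < h]].
have S0 t h : 0 < h -> 0 <= S t h.
  move=> h0; have /andP[a _] := gslope t (t + h) (ltac:(by rewrite lerDl ltW)).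
  by rewrite divr_ge0 // ltW.
have FS t h : 0 < h -> F t <= S t h.
  move=> h0; apply: ge_inf; last by exists h.
  by exists 0 => _ [h' h'0 <-]; exact: S0.
have leF c t : (forall h, 0 < h -> c <= S t h) -> c <= F t.
  move=> H; apply: lb_le_inf; first by exists (S t 1), 1 => /=.
  by move=> _ [h h0 <-]; exact: H.
have SF t h : 0 < h -> S t h <= F (t + h).
  move=> h0; apply: leF => h' h'0; rewrite /S ler_pdivrMr// mulrAC ler_pdivlMr//.
  have th0 : t <= t + h by rewrite lerDl ltW.
  have th1 : t + h <= t + h + h' by rewrite lerDl ltW.
  have := gconv t (t + h) (t + h + h') th0 th1.
  have -> : t + h + h' - (t + h) = h' by rewrite addrC addKr.
  by have -> : t + h - t = h by rewrite addrC addKr.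
have Fnd : {homo F : s t / s <= t}.
  move=> s t; rewrite le_eqVlt => /orP[/eqP->//|st].
  have st0 : 0 < t - s by rewrite subr_gt0.
  by have := le_trans (FS s _ st0) (SF s _ st0); rewrite subrKC.
(* With [h] fixed so that [S x h] is almost the infimum, moving the base point from [x] to [t]
   raises the quotient by at most [(t - x) / h], because [g] is nondecreasing with slopes at most
   1. *)
have Frc : forall x, F @ at_right x --> F x.
  move=> x; apply/cvgrPdist_lt => e e0.
  have [h h0 hS] : exists2 h, 0 < h & S x h < F x + e / 2.
    have hi : has_inf [set S x h | h in [set h | 0 < h]].
      split; first by exists (S x 1), 1 => /=.
      by exists 0 => _ [h' h'0 <-]; exact: S0.
    have [_ [h h0 <-] hS] := inf_adherent (divr_gt0 e0 (ltr0Sn _ 1)) hi.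
    by exists h.
  near=> t.
  have xt : x <= t by near: t; exact: nbhs_right_ge.
  have tx : t < x + h * (e / 2).
    by near: t; apply: nbhs_right_lt; rewrite ltrDl mulr_gt0// divr_gt0.
  rewrite distrC ger0_norm ?subr_ge0 ?Fnd//.
  suff : S t h <= S x h + e / 2 by have := FS t h h0; lra.
  rewrite -(ler_pM2r h0) mulrDl /S !divfK ?gt_eqF//.
  have /andP[_ a] := gslope (x + h) (t + h) (ltac:(by rewrite lerD2r)).
  have /andP[b _] := gslope x t xt.
  lra.
have Fneg t : t < 0 -> F t = 0.
  move=> t0; apply/eqP; rewrite eq_le leF ?andbT; last first.
    by move=> h h0; exact: S0.
  have t1 : 0 < - t by rewrite oppr_gt0.
  apply: le_trans (FS _ _ t1) _.
  by rewrite /S subrr (g0 _ (lexx 0)) (g0 _ (ltW t0)) subrr mul0r.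
have Fpos t : 1 <= t -> F t = 1.
  move=> t0.
  have S1 h : 0 < h -> S t h = 1.
    move=> h0; rewrite /S (g1 (t + h)) ?(g1 t)//; last by lra.
    rewrite (_ : _ - _ = h); last by lra.
    by rewrite divff// gt_eqF.
  apply/eqP; rewrite eq_le -{1}(S1 1 ltr01) FS//= leF// => h h0.
  by rewrite S1.
have FNy : F @ -oo --> (0 : R).
  apply: cvg_near_cst; near=> t; apply: Fneg.
  by near: t; exact: nbhs_ninfty_lt.
have Fy : F @ +oo --> (1 : R).
  apply: cvg_near_cst; near=> t; apply: Fpos.
  by near: t; exact: nbhs_pinfty_ge.
pose cF : cumulativeBounded (0 : R) (1 : R) := HB.pack F
  (isCumulative.Build R _ R F Fnd Frc) (isCumulativeBounded.Build R 0 1 F FNy Fy).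
have [P PF] := cumulative_prob cF.
have {}PF t : distF P t = F t by rewrite PF.
have sP : supp_in 1 P.
  by apply: distF_supp => [t t0|]; rewrite PF; [exact: Fneg|exact: Fpos].
exists P; split=> // t.
pose d t := intF P t - g t.
(* Over a step [h] the difference [d] changes by at most [h] times the increment of [F]. Summing
   over [n + 1] equal steps leaves at most [(b - a) / (n + 1)], so [d] is constant; it vanishes on
   the negative axis. *)
suff d0 : forall a b, a <= b -> d b = d a.
  apply/eqP; rewrite -subr_eq0 -/(d t).
  have := d0 (Num.min 0 t) 0; rewrite ge_min lexx => /(_ isT).
  rewrite -(d0 (Num.min 0 t) t) ?ge_min ?lexx ?orbT// => <-.
  by rewrite /d g0// intF_le0// subrr.
have dstep a h : 0 < h -> `|d (a + h) - d a| <= h * (F (a + h) - F a).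
  move=> h0; have := intF_sandwich a sP (ltW h0); rewrite !PF.
  have := FS a h h0; have := SF a h h0.
  rewrite /S ler_pdivrMr// ler_pdivlMr// => s1 s2 /andP[s3 s4].
  rewrite /d ler_norml; apply/andP; split; lra.
move=> a b; rewrite le_eqVlt => /orP[/eqP->//|ab].
have L n : `|d b - d a| <= (b - a) / n.+1%:R.
  set h := (b - a) / n.+1%:R.
  have h0 : 0 < h by rewrite divr_gt0// subr_gt0.
  have aux k : `|d (a + k%:R * h) - d a| <= h * (F (a + k%:R * h) - F a).
    elim: k => [|k IHk]; first by rewrite mul0r addr0 !subrr normr0 mulr0.
    have -> : a + k.+1%:R * h = a + k%:R * h + h by rewrite -natr1; ring.
    have := dstep (a + k%:R * h) h h0.
    have := ler_normD (d (a + k%:R * h + h) - d (a + k%:R * h)) (d (a + k%:R * h) - d a).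
    by rewrite addrA subrK; lra.
  have := aux n.+1; rewrite /h mulrC divfK// (addrC a) subrK -/h => /le_trans; apply.
  rewrite ler_piMr ?(ltW h0)//.
  have := distF_le1 P b; have := distF_ge0 P a; rewrite !PF; lra.
apply/eqP; rewrite -subr_eq0 -normr_le0; apply/ler_addgt0Pl => e e0.
rewrite addr0; pose n := Num.truncn ((b - a) / e).
apply: le_trans (L n) _; rewrite ler_pdivrMr// mulrC -ler_pdivrMr//.
by rewrite ltW// truncnS_gt.
Unshelve. all: by end_near. Qed.

End ProbabilityFromIntegral.

(** * The averaging operator *)

Section Means.
Context {R : realType} (beta : R) (P : prob R).
Hypothesis sP : supp_in beta P.
Implicit Types f g : R -> R.

Definition bounded_mfun f := measurable_fun `[0, beta]%classic f /\
  exists C, forall k, 0 <= k <= beta -> `|f k| <= C.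

Definition mean f := \int[P]_(k in `[0, beta]%classic) f k.

Lemma bounded_mfun_cst c : bounded_mfun (fun=> c).
Proof. by split; [exact: measurable_cst|exists `|c|]. Qed.

Lemma bounded_mfun_id : bounded_mfun id.
Proof.
by split; [exact: measurable_id|exists beta => k /andP[k0 kb]; rewrite ger0_norm].
Qed.

Lemma bounded_mfunD f g : bounded_mfun f -> bounded_mfun g ->
  bounded_mfun (fun k => f k + g k).
Proof.
move=> [mf [C fC]] [mg [D gD]]; split; first exact: measurable_funD.
by exists (C + D) => k k0; rewrite (le_trans (ler_normD _ _))// lerD ?fC ?gD.
Qed.

Lemma bounded_mfunZ f a : bounded_mfun f -> bounded_mfun (fun k => a * f k).
Proof.
move=> [mf [C fC]]; split; first by apply: measurable_funM => //; exact: measurable_cst.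
by exists (`|a| * C) => k k0; rewrite normrM ler_wpM2l// fC.
Qed.

Lemma bounded_mfun_integrable f : bounded_mfun f ->
  P.-integrable `[0, beta]%classic (EFin \o f).
Proof.
move=> [mf [C fC]]; apply: measurable_bounded_integrable => //.
  by apply: (le_lt_trans (probability_le1 _ _)) => //; exact: ltry.
exists C; split; first exact: num_real.
by move=> r Cr x /=; rewrite in_itv/= => /fC /le_trans; apply; exact: ltW.
Qed.

Lemma EFin_mean f : bounded_mfun f ->
  (mean f)%:E = (\int[P]_(k in `[0%R, beta]%classic) (f k)%:E)%E.
Proof.
move=> /bounded_mfun_integrable If; rewrite fineK//.
exact: integrable_fin_num.
Qed.

Lemma mean_lincomb a b f g : bounded_mfun f -> bounded_mfun g ->
  mean (fun k => a * f k + b * g k) = a * mean f + b * mean g.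
Proof.
move=> bf bg; rewrite /mean (RintegralD _ (bounded_mfun_integrable (bounded_mfunZ a bf))
  (bounded_mfun_integrable (bounded_mfunZ b bg)))//.
by rewrite (RintegralZl _ _ (bounded_mfun_integrable bf))// (RintegralZl _ _ (bounded_mfun_integrable bg)).
Qed.

Lemma mean_cst c : mean (fun=> c) = c.
Proof. by rewrite /mean Rintegral_cst// [X in fine X]sP mulr1. Qed.

Lemma mean_le f g : bounded_mfun f -> bounded_mfun g ->
  (forall k, 0 <= k <= beta -> f k <= g k) -> mean f <= mean g.
Proof.
move=> bf bg fg; apply: le_Rintegral => //; exact: bounded_mfun_integrable.
Qed.

Lemma eq_mean f g : (forall k, 0 <= k <= beta -> f k = g k) -> mean f = mean g.
Proof. by move=> fg; apply: eq_Rintegral => k; rewrite inE/= in_itv/=; exact: fg. Qed.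

Lemma mean_le_affine f a b : bounded_mfun f ->
  (forall k, 0 <= k <= beta -> f k <= a + b * k) -> mean f <= a + b * mean id.
Proof.
move=> bf fab; rewrite -(mean_cst a) -[X in X + _]mul1r.
rewrite -(mean_lincomb _ _ (bounded_mfun_cst a) bounded_mfun_id); apply: mean_le => //.
- apply: bounded_mfunD; apply: bounded_mfunZ;
  [exact: bounded_mfun_cst|exact: bounded_mfun_id].
- by move=> k k0; rewrite mul1r fab.
Qed.

Lemma bounded_mfun_lim (u_ : nat -> R -> R) f C :
  (forall n, measurable_fun `[0, beta]%classic (u_ n)) ->
  (forall n k, 0 <= k <= beta -> `|u_ n k| <= C) ->
  (forall k, 0 <= k <= beta -> u_ n k @[n --> \oo] --> f k) ->
  bounded_mfun f /\ mean (u_ n) @[n --> \oo] --> mean f.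
Proof.
move=> mu_ uC uf.
have mf : measurable_fun `[0, beta]%classic f.
  by apply: (measurable_fun_cvg mu_) => k /=; rewrite in_itv/=; exact: uf.
have bf : bounded_mfun f.
  split=> //; exists C => k k0.
  apply: (cvgr_to_le (cvg_norm (uf k k0))); near=> n; exact: uC.
split=> //.
have bu n : bounded_mfun (u_ n) by split => //; exists C => k; exact: uC.
have cvgE : {ae P, forall k, `[0, beta]%classic k ->
    (u_ n k)%:E @[n --> \oo] --> (EFin \o f) k}.
  apply/aeW => k; rewrite /= in_itv/= => k0.
  by apply/fine_cvgP; split; [near=> n|exact: uf].
have domE : {ae P, forall k n, `[0, beta]%classic k -> (`|(u_ n k)%:E| <= (cst C%:E) k)%E}.
  by apply/aeW => k n; rewrite /= in_itv/= => k0; rewrite lee_fin uC.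
have [_ _ H] := dominated_convergence (measurable_itv _)
  (fun n => (measurable_EFinP _ _).2 (mu_ n)) ((measurable_EFinP _ _).2 mf)
  cvgE (bounded_mfun_integrable (bounded_mfun_cst C)) domE.
by apply/fine_cvg; rewrite -/(mean f) EFin_mean.
Unshelve. all: by end_near. Qed.

End Means.

Section Averaging.
Context {R : realType} (beta : R) (mu nu : prob R) (m : R).
Hypothesis smu : supp_in beta mu.
Hypothesis snu : supp_in beta nu.
Hypothesis mean_mu : mean beta mu id = m.
Hypothesis mean_nu : mean beta nu id = m.
Implicit Types u v : R -> R -> R.

(** Without measurability and a bound on the segments that one step can reach, [mean] may take a
    default value; linearity and monotonicity of [avg] at a point are stated under this
    condition. *)
Definition rays u x y :=
  bounded_mfun beta (fun k => u (x + k) y) /\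
  bounded_mfun beta (fun k => u x (y + k)).

(* One step of the urn: with probability [x / (x + y)] add a [mu]-distributed
   amount to [x], otherwise add a [nu]-distributed amount to [y]. *)
Definition avg u x y := (x * mean beta mu (fun k => u (x + k) y) +
  y * mean beta nu (fun k => u x (y + k))) / (x + y).

Definition harmonic_at u x y := rays u x y /\ u x y = avg u x y.

Lemma inS_gt0 (x y : R) : inS x y -> 0 < x + y.
Proof.
move=> [x0 [y0 xy]]; rewrite lt_neqAle addr_ge0// andbT eq_sym paddr_eq0//.
by apply/negP => /andP[/eqP xE /eqP yE]; apply: xy; rewrite xE yE.
Qed.

Lemma inS_addl (x y k : R) : inS x y -> 0 <= k -> inS (x + k) y.
Proof.
move=> xyS k0; have s0 := inS_gt0 xyS; have [x0 [y0 _]] := xyS.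
split; [exact: addr_ge0|split=> // -[xk y00]]; lra.
Qed.

Lemma inS_addr (x y k : R) : inS x y -> 0 <= k -> inS x (y + k).
Proof.
move=> xyS k0; have s0 := inS_gt0 xyS; have [x0 [y0 _]] := xyS.
split; [by []|split; [exact: addr_ge0|move=> -[x00 yk]]]; lra.
Qed.

(** Equality of the means puts the same [m] in front of both slopes, which combine as
    [x * b1 + y * b2]; contributions of the two colours can then cancel. *)
Lemma avg_le_affine u x y a1 b1 a2 b2 : inS x y -> rays u x y ->
  (forall k, 0 <= k <= beta -> u (x + k) y <= a1 + b1 * k) ->
  (forall k, 0 <= k <= beta -> u x (y + k) <= a2 + b2 * k) ->
  avg u x y <= (x * (a1 + b1 * m) + y * (a2 + b2 * m)) / (x + y).
Proof.
move=> xyS [u1 u2] h1 h2; have s0 := inS_gt0 xyS; have [x0 [y0 _]] := xyS.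
rewrite ler_pM2r ?invr_gt0// lerD// ler_wpM2l//.
- by rewrite -mean_mu mean_le_affine.
- by rewrite -mean_nu mean_le_affine.
Qed.

Lemma rays_lincomb u v a b x y : rays u x y -> rays v x y ->
  rays (fun x y => a * u x y + b * v x y) x y.
Proof.
by move=> [u1 u2] [v1 v2]; split; apply: bounded_mfunD; exact: bounded_mfunZ.
Qed.

Lemma rays_cst c x y : rays (fun _ _ => c) x y.
Proof. by split; exact: bounded_mfun_cst. Qed.

Lemma avg_lincomb u v a b x y : rays u x y -> rays v x y ->
  avg (fun x y => a * u x y + b * v x y) x y = a * avg u x y + b * avg v x y.
Proof. by move=> [u1 u2] [v1 v2]; rewrite /avg !mean_lincomb//; ring. Qed.

Lemma avg_cst c x y : inS x y -> avg (fun _ _ => c) x y = c.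
Proof.
move=> /inS_gt0 s0; rewrite /avg !mean_cst// -mulrDl mulrAC divff ?gt_eqF//.
by rewrite mul1r.
Qed.

Lemma harmonic_at_cst c x y : inS x y -> harmonic_at (fun _ _ => c) x y.
Proof. by move=> xyS; split; [exact: rays_cst|rewrite avg_cst]. Qed.

Lemma harmonic_at_lincomb u v a b x y : harmonic_at u x y -> harmonic_at v x y ->
  harmonic_at (fun x y => a * u x y + b * v x y) x y.
Proof.
move=> [lu hu] [lv hv]; split; first exact: rays_lincomb.
by rewrite avg_lincomb// -hu -hv.
Qed.

Lemma eq_avg u v x y : inS x y -> (forall x y, inS x y -> u x y = v x y) ->
  avg u x y = avg v x y.
Proof.
move=> xyS uv; rewrite /avg; congr ((x * _ + y * _) / _); apply: eq_mean => k.
- by move=> /andP[k0 _]; apply: uv; exact: inS_addl.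
- by move=> /andP[k0 _]; apply: uv; exact: inS_addr.
Qed.

Lemma eq_rays u v x y : inS x y -> (forall x y, inS x y -> u x y = v x y) ->
  rays u x y -> rays v x y.
Proof.
move=> xyS uv [[mu1 [C1 b1]] [mu2 [C2 b2]]]; split; split.
- apply: eq_measurable_fun mu1 => k; rewrite inE/= in_itv/= => /andP[k0 _].
  by apply: uv; exact: inS_addl.
- by exists C1 => k kb; rewrite -uv ?b1//; apply: inS_addl => //; case/andP: kb.
- apply: eq_measurable_fun mu2 => k; rewrite inE/= in_itv/= => /andP[k0 _].
  by apply: uv; exact: inS_addr.
- by exists C2 => k kb; rewrite -uv ?b2//; apply: inS_addr => //; case/andP: kb.
Qed.

Lemma eq_harmonic_at u v x y : inS x y -> (forall x y, inS x y -> u x y = v x y) ->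
  harmonic_at u x y -> harmonic_at v x y.
Proof.
move=> xyS uv [lu hu]; split; first exact: eq_rays lu.
by rewrite -uv// hu; exact: eq_avg.
Qed.

Lemma avg_lim (u_ : nat -> R -> R -> R) v x y C : inS x y ->
  (forall n, rays (u_ n) x y) ->
  (forall n x y, inS x y -> `|u_ n x y| <= C) ->
  (forall x y, inS x y -> u_ n x y @[n --> \oo] --> v x y) ->
  rays v x y /\ avg (u_ n) x y @[n --> \oo] --> avg v x y.
Proof.
move=> xyS ru uC uv.
have [v1 c1] : bounded_mfun beta (fun k => v (x + k) y) /\
    mean beta mu (fun k => u_ n (x + k) y) @[n --> \oo] -->
      mean beta mu (fun k => v (x + k) y).
  apply: (@bounded_mfun_lim _ _ _ (fun n k => u_ n (x + k) y) _ C).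
  - by move=> n; have [[? _] _] := ru n.
  - by move=> n k /andP[k0 _]; apply: uC; exact: inS_addl.
  - by move=> k /andP[k0 _]; apply: uv; exact: inS_addl.
have [v2 c2] : bounded_mfun beta (fun k => v x (y + k)) /\
    mean beta nu (fun k => u_ n x (y + k)) @[n --> \oo] -->
      mean beta nu (fun k => v x (y + k)).
  apply: (@bounded_mfun_lim _ _ _ (fun n k => u_ n x (y + k)) _ C).
  - by move=> n; have [_ [? _]] := ru n.
  - by move=> n k /andP[k0 _]; apply: uC; exact: inS_addr.
  - by move=> k /andP[k0 _]; apply: uv; exact: inS_addr.
split=> //.
by apply: cvgM; [apply: cvgD; apply: cvgM => //; exact: cvg_cst|exact: cvg_cst].
Qed.

(** Dominated convergence. Used three times: difference quotients lead from [intF] to [distF],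
    Riemann sums lead back, and partial sums give countable unions. *)
Lemma harmonic_at_lim (u_ : nat -> R -> R -> R) v x y C : inS x y ->
  (forall n, harmonic_at (u_ n) x y) ->
  (forall n x y, inS x y -> `|u_ n x y| <= C) ->
  (forall x y, inS x y -> u_ n x y @[n --> \oo] --> v x y) ->
  harmonic_at v x y.
Proof.
move=> xyS hu uC uv.
have [rv cv] := avg_lim xyS (fun n => (hu n).1) uC uv.
split=> //; apply: (@cvg_unique _ _ (u_ n x y @[n --> \oo])) => //.
  exact: uv.
have -> : (fun n => u_ n x y) = (fun n => avg (u_ n) x y).
  by apply/funext => n; have [_] := hu n.
exact: cv.
Qed.

End Averaging.

(** * Maximum principle from the contraction of an exponential *)

Section Comparison.
Context {R : realType} (beta : R) (mu nu : prob R) (m : R).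
Hypothesis beta0 : 0 < beta.
Hypothesis smu : supp_in beta mu.
Hypothesis snu : supp_in beta nu.
Hypothesis mean_mu : mean beta mu id = m.
Hypothesis mean_nu : mean beta nu id = m.
Hypothesis m0 : 0 < m.
Implicit Types u v : R -> R -> R.

Local Notation avg := (avg beta mu nu).
Local Notation harmonic_at := (harmonic_at beta mu nu).

Definition decay := 1 - m / (1 + beta).

Lemma decay_ge0 : 0 <= decay.
Proof.
rewrite subr_ge0 ler_pdivrMr ?mul1r; last by rewrite addr_gt0.
suff : m <= beta by move=> /le_trans; apply; rewrite lerDr.
rewrite -mean_mu -[leRHS](mean_cst smu); apply: mean_le => //.
- exact: bounded_mfun_id.
- exact: bounded_mfun_cst.
- by move=> k /andP[].
Qed.

Lemma decay_lt1 : decay < 1.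
Proof. by rewrite gtrBl divr_gt0// addr_gt0. Qed.

(** Since [1 + k <= expR k], the left side is at most [1 / (1 + k)], whose chord over [[0, beta]] is
    the right side. The mean of this chord under [mu] or [nu] is [decay]. *)
Lemma expRN_le_chord (k : R) : 0 <= k <= beta -> expR (- k) <= 1 - k / (1 + beta).
Proof.
move=> /andP[k0 kb]; have b1 : 0 < 1 + beta by rewrite addr_gt0.
have k1 : 0 < 1 + k by rewrite ltr_pwDl.
rewrite expRN; apply: (@le_trans _ _ (1 + k)^-1).
  by rewrite lef_pV2 ?posrE ?expR_gt0// expR_ge1Dx.
rewrite -[leLHS]mul1r ler_pdivrMr// -(ler_pM2r b1) mulrAC mulrBl divfK ?gt_eqF//.
nra.
Qed.

Lemma avg_le_expR u x y a b : inS x y -> rays beta u x y -> 0 <= b ->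
  (forall x y, inS x y -> u x y <= a + b * expR (- (x + y))) ->
  avg u x y <= a + b * decay * expR (- (x + y)).
Proof.
move=> xyS ru b0 ub; have s0 := inS_gt0 xyS; set E := expR (- (x + y)).
have step t k : 0 <= k <= beta -> t = x + y + k ->
    a + b * expR (- t) <= a + b * E + (- (b * E / (1 + beta))) * k.
  move=> kb ->; rewrite opprD expRD -/E -addrA lerD2l mulrA.
  rewrite (_ : _ + _ = b * E * (1 - k / (1 + beta))); last by ring.
  by rewrite ler_wpM2l ?expRN_le_chord// mulr_ge0// expR_ge0.
have := avg_le_affine smu snu mean_mu mean_nu xyS ru
  (fun k kb => le_trans (ub _ _ (inS_addl xyS (proj1 (andP kb))))
    (step _ _ kb (addrAC _ _ _)))
  (fun k kb => le_trans (ub _ _ (inS_addr xyS (proj1 (andP kb))))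
    (step _ _ kb (addrA _ _ _))).
rewrite -mulrDl mulrAC divff ?gt_eqF// mul1r => /le_trans; apply.
by rewrite /decay -addrA lerD2l le_eqVlt; apply/orP; left; apply/eqP; ring.
Qed.

Lemma avg_opp u x y : rays beta u x y ->
  rays beta (fun x y => - u x y) x y /\ avg (fun x y => - u x y) x y = - avg u x y.
Proof.
move=> ru; have E : (fun x y => - u x y) = (fun x y => -1 * u x y + 0 * u x y).
  by apply/funext => a; apply/funext => b; ring.
rewrite E; split; first exact: rays_lincomb.
by rewrite avg_lincomb//; ring.
Qed.

Lemma avg_norm_le_expR u x y a b : inS x y -> rays beta u x y -> 0 <= b ->
  (forall x y, inS x y -> `|u x y| <= a + b * expR (- (x + y))) ->
  `|avg u x y| <= a + b * decay * expR (- (x + y)).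
Proof.
move=> xyS ru b0 ub; have [ru' E] := avg_opp ru.
rewrite ler_norml lerNl -E !avg_le_expR// => x' y' S'.
- by have := ub _ _ S'; rewrite ler_norml => /andP[].
- by have := ub _ _ S'; rewrite ler_norml lerNl => /andP[].
Qed.

Lemma cvg_decay (a b : R) : a + b * decay ^+ n @[n --> \oo] --> a.
Proof.
rewrite -[X in _ --> X]addr0 -(mulr0 b); apply: cvgD; first exact: cvg_cst.
apply: cvgM; first exact: cvg_cst.
by apply: cvg_expr; rewrite ger0_norm ?decay_ge0 ?decay_lt1.
Qed.

(* The exponential [expR (- (x + y))] is multiplied by at most [decay < 1] under
   [avg], so a bound valid for large [x + y] propagates to all of S. *)
Lemma harmonic_le u C M e : (forall x y, inS x y -> harmonic_at u x y) ->
  (forall x y, inS x y -> u x y <= C) ->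
  (forall x y, inS x y -> M <= x + y -> u x y <= e) ->
  forall x y, inS x y -> u x y <= e.
Proof.
move=> hu uC uM.
(* Chosen so that [B * expR (- (x + y))] is at least [C - e] wherever [x + y < M]; from [M] on the
   bound [e] is given. *)
pose B := Num.max 0 (C - e) * expR M.
have B0 : 0 <= B by rewrite mulr_ge0 ?expR_ge0// le_max lexx.
have bound n : forall x y, inS x y -> u x y <= e + B * decay ^+ n * expR (- (x + y)).
  elim: n => [x y xyS|n IHn x y xyS].
    rewrite expr0 mulr1; have [Ms|sM] := leP M (x + y).
      by rewrite (le_trans (uM _ _ xyS Ms))// lerDl mulr_ge0 ?expR_ge0.
    rewrite (le_trans (uC _ _ xyS))// -lerBlDl -mulrA -expRD.
    have : C - e <= Num.max 0 (C - e) by rewrite le_max lexx orbT.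
    move=> /le_trans; apply; rewrite ler_peMr ?le_max ?lexx//.
    by rewrite -expR0 ler_expR subr_ge0 ltW.
  have [ru ->] := hu _ _ xyS.
  rewrite exprSr mulrA; apply: avg_le_expR => //.
  by rewrite mulr_ge0// exprn_ge0// decay_ge0.
move=> x y xyS.
apply: (cvgr_to_ge (@cvg_decay e (B * expR (- (x + y))))).
by near=> n; rewrite mulrAC bound.
Unshelve. all: by end_near. Qed.

End Comparison.

(** * Continuity preserved by averaging *)

Section Regularity.
Context {R : realType} (beta : R) (mu nu : prob R).
Hypothesis smu : supp_in beta mu.
Hypothesis snu : supp_in beta nu.
Implicit Types u v : R -> R -> R.

Definition bounded_inS u := exists C, forall x y, inS x y -> `|u x y| <= C.

Definition continuous_inS u := forall x y, inS x y -> forall e, 0 < e ->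
  exists2 d, 0 < d & forall x' y', inS x' y' -> `|x' - x| < d -> `|y' - y| < d ->
    `|u x' y' - u x y| < e.

(** Proportions are Lipschitz only away from the origin, hence the restriction to [c <= x + y].
    Increments only enlarge [x + y], so one [d] serves all shifted points under the integral. *)
Definition unif_continuous_inS u := forall c e, 0 < c -> 0 < e ->
  exists2 d, 0 < d & forall x y x' y', inS x y -> inS x' y' ->
    c <= x + y -> c <= x' + y' -> `|x' - x| < d -> `|y' - y| < d ->
    `|u x' y' - u x y| < e.

Lemma continuous_inS_rays u x y : continuous_inS u -> bounded_inS u -> inS x y ->
  rays beta u x y.
Proof.
move=> cu [C uC] xyS.
have mes (f : R -> R) : (forall k, 0 <= k -> forall e, 0 < e -> exists2 d, 0 < d &
    forall k', 0 <= k' -> `|k' - k| < d -> `|f k' - f k| < e) ->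
    measurable_fun `[0, beta]%classic f.
  (* Composing with the absolute value turns continuity on [k >= 0] into continuity on the whole
     line, hence measurability. *)
  move=> cf; suff mf : measurable_fun `[0, beta]%classic (fun k => f `|k|).
    apply: eq_measurable_fun mf => k.
    by rewrite inE/= in_itv/= => /andP[k0 _]; rewrite ger0_norm.
  apply: measurable_funTS; apply: continuous_measurable_fun => k.
  apply/cvgrPdist_lt => e e0; have [d d0 H] := cf _ (normr_ge0 k) _ e0.
  near=> k'; rewrite distrC; apply: H => //.
  apply: le_lt_trans (ler_dist_dist _ _) _; rewrite distrC.
  by near: k'; exact: (@nbhsx_ballx _ R^o k d d0).
split; split.
- apply: mes => k k0 e e0; have [d d0 H] := cu _ _ (inS_addl xyS k0) _ e0.
  exists d => // k' k'0 kk'; apply: H; [exact: inS_addl| |by rewrite subrr normr0].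
  by rewrite opprD addrACA subrr add0r.
- by exists C => k /andP[k0 _]; apply: uC; exact: inS_addl.
- apply: mes => k k0 e e0; have [d d0 H] := cu _ _ (inS_addr xyS k0) _ e0.
  exists d => // k' k'0 kk'; apply: H; [exact: inS_addr|by rewrite subrr normr0|].
  by rewrite opprD addrACA subrr add0r.
- by exists C => k /andP[k0 _]; apply: uC; exact: inS_addr.
Unshelve. all: by end_near. Qed.

Lemma unif_continuous_inSW u : unif_continuous_inS u -> continuous_inS u.
Proof.
move=> ucu x y xyS e e0; have s0 := inS_gt0 xyS.
have c0 : 0 < (x + y) / 2 by rewrite divr_gt0.
have [d d0 H] := ucu _ _ c0 e0.
exists (Num.min d ((x + y) / 4)); first by rewrite lt_min d0 divr_gt0.
move=> x' y' xyS'; rewrite !lt_min => /andP[xd xs] /andP[yd ys].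
by apply: H => //; move: xs ys; rewrite !ltr_norml => /andP[? _] /andP[? _]; lra.
Qed.

Lemma proportion_in01 (x y : R) : inS x y -> 0 <= x / (x + y) <= 1.
Proof.
move=> xyS; have s0 := inS_gt0 xyS; have [x0 [y0 _]] := xyS.
by rewrite divr_ge0 ?(ltW s0)//= ler_pdivrMr// mul1r lerDl.
Qed.

(** The numerator of the difference is [(x' - x) * y - x * (y' - y)], at most [d * (x + y)] in size;
    [x + y] cancels and leaves [x' + y' >= c] below. *)
Lemma proportion_lipschitz (c d x y x' y' : R) : inS x y -> inS x' y' ->
  0 < c -> c <= x' + y' -> `|x' - x| <= d -> `|y' - y| <= d ->
  `|x' / (x' + y') - x / (x + y)| <= d / c.
Proof.
move=> xyS xyS' c0 cs xd yd.
have s0 := inS_gt0 xyS; have [x0 [y0 _]] := xyS; have s0' := inS_gt0 xyS'.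
have -> : x' / (x' + y') - x / (x + y) =
    ((x' - x) * y - x * (y' - y)) / ((x + y) * (x' + y')).
  by field; rewrite !gt_eqF.
rewrite normrM normfV normrM (gtr0_norm s0) (gtr0_norm s0') ler_pdivrMr ?mulr_gt0//.
apply: (@le_trans _ _ (d * (x + y))).
  rewrite (le_trans (ler_normB _ _))// !normrM (ger0_norm x0) (ger0_norm y0).
  have := ler_wpM2r y0 xd; have := ler_wpM2l x0 yd; lra.
have d0 : 0 <= d by rewrite (le_trans _ xd).
rewrite [leRHS](_ : _ = d * (x + y) * ((x' + y') / c)); last by ring.
by rewrite ler_peMr ?mulr_ge0 ?(ltW s0)// ler_pdivlMr// mul1r.
Qed.

Lemma mean_dist (P : prob R) (f g : R -> R) e : supp_in beta P ->
  bounded_mfun beta f -> bounded_mfun beta g ->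
  (forall k, 0 <= k <= beta -> `|f k - g k| <= e) ->
  `|mean beta P f - mean beta P g| <= e.
Proof.
move=> sP bf bg fg.
have le (f' g' : R -> R) : bounded_mfun beta f' -> bounded_mfun beta g' ->
    (forall k, 0 <= k <= beta -> `|f' k - g' k| <= e) ->
    mean beta P f' <= e + mean beta P g'.
  move=> bf' bg' h; rewrite -(mean_cst sP e) -[X in X + _]mul1r -[X in _ + X]mul1r.
  rewrite -mean_lincomb//; last exact: bounded_mfun_cst.
  apply: mean_le => //; last first.
    by move=> k /h; rewrite ler_norml => /andP[_]; lra.
  by apply: bounded_mfunD; apply: bounded_mfunZ => //; exact: bounded_mfun_cst.
rewrite ler_norml; have h1 := le _ _ bf bg fg.
have h2 : mean beta P g <= e + mean beta P f.
  by apply: le => // k k0; rewrite distrC fg.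
by apply/andP; split; lra.
Qed.

Lemma avg_unif_continuous_inS u : bounded_inS u -> unif_continuous_inS u ->
  bounded_inS (avg beta mu nu u) /\ unif_continuous_inS (avg beta mu nu u).
Proof.
move=> [C uC] ucu.
have ru x y : inS x y -> rays beta u x y.
  by move=> xyS; apply: continuous_inS_rays xyS; [exact: unif_continuous_inSW|exists C].
have C0 : 0 <= C.
  have S10 : inS (1 : R) 0 by split; [|split=> //; move=> [/eqP]; rewrite oner_eq0].
  by rewrite (le_trans _ (uC _ _ S10)).
have mb x y : inS x y -> `|mean beta mu (fun k => u (x + k) y)| <= C /\
    `|mean beta nu (fun k => u x (y + k))| <= C.
  move=> xyS; have [r1 r2] := ru _ _ xyS; split.
  - rewrite -[X in `|X|]subr0 -(mean_cst smu 0); apply: mean_dist => //.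
      exact: bounded_mfun_cst.
    by move=> k /andP[k0 _]; rewrite subr0 uC//; exact: inS_addl.
  - rewrite -[X in `|X|]subr0 -(mean_cst snu 0); apply: mean_dist => //.
      exact: bounded_mfun_cst.
    by move=> k /andP[k0 _]; rewrite subr0 uC//; exact: inS_addr.
have avgE x y : inS x y -> avg beta mu nu u x y =
    x / (x + y) * mean beta mu (fun k => u (x + k) y) +
    (1 - x / (x + y)) * mean beta nu (fun k => u x (y + k)).
  by move=> /inS_gt0 s0; rewrite /avg; field; rewrite gt_eqF.
split.
  exists C => x y xyS; rewrite avgE//.
  have [m1 m2] := mb _ _ xyS; have /andP[z0 z1] := proportion_in01 xyS.
  move: (x / (x + y)) z0 z1 => z z0 z1.
  rewrite (le_trans (ler_normD _ _))// !normrM (ger0_norm z0).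
  rewrite (@ger0_norm _ (1 - z)) ?subr_ge0//.
  have z10 : 0 <= 1 - z by rewrite subr_ge0.
  have := ler_wpM2l z0 m1; have := ler_wpM2l z10 m2; lra.
move=> c e c0 e0; have [d d0 H] := ucu c (e / 2) c0 (divr_gt0 e0 (ltr0Sn _ 1)).
(* Changing the weights from [z] to [z'] costs at most [d' / c] times the gap [2 * C] between two
   means. This [d'] makes the cost at most [e / 4], on top of [e / 2] from the means. *)
pose d' := e * c / (8 * (C + 1)).
have C1 : 0 < 8 * (C + 1) by rewrite mulr_gt0// ltr_wpDl.
have d'0 : 0 < d' by rewrite divr_gt0// mulr_gt0.
exists (Num.min d d'); first by rewrite lt_min d0.
move=> x y x' y' S S' cs cs'; rewrite !lt_min => /andP[xd xd'] /andP[yd yd'].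
have shift (a b k : R) : a + k - (b + k) = a - b by ring.
rewrite !avgE//.
have := proportion_lipschitz S S' c0 cs' (ltW xd') (ltW yd').
have [r1 r2] := ru _ _ S; have [r1' r2'] := ru _ _ S'.
have : `|mean beta mu (fun k => u (x' + k) y') - mean beta mu (fun k => u (x + k) y)| <= e / 2.
  apply: mean_dist => // k /andP[k0 _]; apply/ltW/H => //.
  - exact: inS_addl.
  - exact: inS_addl.
  - by rewrite addrAC (le_trans cs)// lerDl.
  - by rewrite addrAC (le_trans cs')// lerDl.
  - by rewrite shift.
have : `|mean beta nu (fun k => u x' (y' + k)) - mean beta nu (fun k => u x (y + k))| <= e / 2.
  apply: mean_dist => // k /andP[k0 _]; apply/ltW/H => //.
  - exact: inS_addr.
  - exact: inS_addr.
  - by rewrite addrA (le_trans cs)// lerDl.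
  - by rewrite addrA (le_trans cs')// lerDl.
  - by rewrite shift.
have [m1 m2] := mb _ _ S; have /andP[z0 z1] := proportion_in01 S'.
move: m1 m2 z0 z1.
move: (x / (x + y)) (x' / (x' + y')) => z z'.
move: (mean beta mu (fun k => u (x + k) y)) (mean beta nu (fun k => u x (y + k))).
move: (mean beta mu (fun k => u (x' + k) y')) (mean beta nu (fun k => u x' (y' + k))).
move=> E1' E2' E1 E2 m1 m2 z0 z1 h2 h1 zz.
have -> : z' * E1' + (1 - z') * E2' - (z * E1 + (1 - z) * E2) =
  z' * (E1' - E1) + (1 - z') * (E2' - E2) + (z' - z) * (E1 - E2) by ring.
have dc : d' / c * (2 * C) <= e / 4.
  have -> : d' / c * (2 * C) = e / 4 * (C / (C + 1)).
    by rewrite /d'; field; rewrite !gt_eqF// ltr_wpDl.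
  have q : C / (C + 1) <= 1 by rewrite ler_pdivrMr ?ltr_wpDl// mul1r lerDl.
  by rewrite ler_piMr// ltW// divr_gt0.
have k1 : `|z' * (E1' - E1)| <= z' * (e / 2) by rewrite normrM (ger0_norm z0) ler_wpM2l.
have k2 : `|(1 - z') * (E2' - E2)| <= (1 - z') * (e / 2).
  by rewrite normrM ger0_norm ?subr_ge0// ler_wpM2l// subr_ge0.
have k3 : `|(z' - z) * (E1 - E2)| <= d' / c * (2 * C).
  by rewrite normrM ler_pM// (le_trans (ler_normB _ _))//; lra.
have := ler_normD (z' * (E1' - E1) + (1 - z') * (E2' - E2)) ((z' - z) * (E1 - E2)).
have := ler_normD (z' * (E1' - E1)) ((1 - z') * (E2' - E2)).
lra.
Qed.

Lemma unif_continuous_inS_lim (u_ : nat -> R -> R -> R) v :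
  (forall n, unif_continuous_inS (u_ n)) ->
  (forall e, 0 < e -> exists n, forall x y, inS x y -> `|v x y - u_ n x y| <= e) ->
  unif_continuous_inS v.
Proof.
move=> ucu uv c e c0 e0.
have e4 : 0 < e / 4 by rewrite divr_gt0.
have [n un] := uv _ e4; have [d d0 H] := ucu n c _ c0 e4.
exists d => // x y x' y' S S' cs cs' xd yd.
have := H _ _ _ _ S S' cs cs' xd yd; have := un _ _ S; have := un _ _ S'.
have := ler_normD (v x' y' - u_ n x' y') (u_ n x' y' - u_ n x y).
have := ler_normB (v x' y' - u_ n x' y' + (u_ n x' y' - u_ n x y)) (v x y - u_ n x y).
rewrite [X in `|X| <= _](_ : _ = v x' y' - v x y); last by ring.
lra.
Qed.

End Regularity.

(** * The Dirichlet problem at infinity *)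

Section Dirichlet.
Context {R : realType} (beta : R) (mu nu : prob R) (m : R).
Hypothesis beta0 : 0 < beta.
Hypothesis smu : supp_in beta mu.
Hypothesis snu : supp_in beta nu.
Hypothesis mean_mu : mean beta mu id = m.
Hypothesis mean_nu : mean beta nu id = m.
Hypothesis m0 : 0 < m.
Implicit Types u v : R -> R -> R.

Local Notation avg := (avg beta mu nu).
Local Notation harmonic_at := (harmonic_at beta mu nu).
Local Notation decay := (decay beta m).

(* The squared deviation of the proportion [x / (x + y)] from [z0] increases
   by O((x + y)^-2) on average because the two means agree; the second term
   compensates this. *)
Definition barrier (z0 x y : R) :=
  (x / (x + y) - z0) ^+ 2 + 8 * beta ^+ 2 / m * (x + y + beta)^-1.

(** Size of the second-order errors of one step. [4 * E s] equals [m] times the linear gain of the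
    second barrier term, which is what fixes its constant [8 * beta ^+ 2 / m]. *)
Let E s := 2 * beta ^+ 2 / ((s + beta) * (s + 2 * beta)).

(** [k / (s + k)] is the share of the added mass and [k / (s + beta)] its linear replacement; the
    error factors as [k / (s + k) * ((beta - k) / (s + beta))]. *)
Let reinforcement_ratio (s k : R) : 0 < s -> 0 <= k <= beta ->
  [/\ 0 <= k / (s + k) - k / (s + beta), k / (s + k) - k / (s + beta) <= E s,
      0 <= k / (s + k) & (k / (s + k)) ^+ 2 <= 2 * E s].
Proof.
move=> s0 /andP[k0 kb].
have sk : 0 < s + k by rewrite ltr_pwDl.
have sb : 0 < s + beta by rewrite addr_gt0.
have s2b : 0 < s + 2 * beta by rewrite addr_gt0// mulr_gt0.
have r0 : 0 <= k / (s + k) by rewrite divr_ge0// ltW.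
have r1 : k / (s + k) <= 2 * beta / (s + 2 * beta).
  rewrite ler_pdivrMr// mulrAC ler_pdivlMr//; nra.
have EE : E s = 2 * beta / (s + 2 * beta) * (beta / (s + beta)).
  by rewrite /E; field; rewrite !gt_eqF.
have dE : k / (s + k) - k / (s + beta) = k / (s + k) * ((beta - k) / (s + beta)).
  by field; rewrite !gt_eqF.
have bk0 : 0 <= (beta - k) / (s + beta) by rewrite divr_ge0 ?subr_ge0// ltW.
split=> //.
- by rewrite dE mulr_ge0.
- by rewrite dE EE ler_pM// ler_pM2r ?invr_gt0// gerBl.
- rewrite expr2 EE (_ : 2 * _ = 2 * beta / (s + 2 * beta) * (2 * beta / (s + beta))); last by ring.
  apply: ler_pM => //; apply: le_trans r1 _.
  by rewrite ler_pM2l ?mulr_gt0// lef_pV2 ?posrE// lerD2l; lra.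
Qed.

(** [z + w * (k / (s + k))] is the new proportion, with [w = 1 - z] after adding to [x] and
    [w = - z] after adding to [y]. In the expanded square, linearising the cross term costs
    [2 * E s] and the quadratic term another [2 * E s]. *)
Let barrier_step (s k z0 z w : R) : 0 < s -> 0 <= k <= beta ->
  0 <= z0 <= 1 -> 0 <= z <= 1 -> `|w| <= 1 ->
  (z + w * (k / (s + k)) - z0) ^+ 2 + 8 * beta ^+ 2 / m * (s + k + beta)^-1 <=
  ((z - z0) ^+ 2 + 4 * E s + 8 * beta ^+ 2 / m * (s + beta)^-1) +
  (2 * (z - z0) * w / (s + beta)
     - 8 * beta ^+ 2 / m / ((s + beta) * (s + 2 * beta))) * k.
Proof.
move=> s0 kb z01 z1 w1; have [d0 dE r0 r2] := reinforcement_ratio s0 kb.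
have /andP[k0 kb'] := kb.
have sb : 0 < s + beta by rewrite addr_gt0.
have s2b : 0 < s + 2 * beta by rewrite addr_gt0// mulr_gt0.
have skb : 0 < s + k + beta by rewrite addr_gt0// ltr_pwDl.
set r := k / (s + k) in d0 dE r0 r2 *; set e := E s in dE r2 *.
set K := 8 * beta ^+ 2 / m.
have K0 : 0 <= K by rewrite /K divr_ge0 ?(ltW m0)// mulr_ge0// sqr_ge0.
have wK : K * (s + k + beta)^-1 <= K * (s + beta)^-1 - K / ((s + beta) * (s + 2 * beta)) * k.
  rewrite [leRHS](_ : _ = K * ((s + 2 * beta - k) / ((s + beta) * (s + 2 * beta)))); last first.
    by field; rewrite !gt_eqF.
  apply: ler_wpM2l => //.
  rewrite ler_pdivlMr ?mulr_gt0// mulrC ler_pdivrMr//.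
  nra.
have u1 : `|(z - z0) * w| <= 1.
  rewrite normrM -[leRHS]mulr1 ler_pM// ler_norml.
  by move: z01 z1 => /andP[? ?] /andP[? ?]; apply/andP; split; lra.
have c1 : (z - z0) * w * (r - k / (s + beta)) <= e.
  apply: le_trans (ler_norm _) _; rewrite normrM (ger0_norm d0) -[leRHS]mul1r.
  exact: ler_pM.
have c2 : w ^+ 2 * r ^+ 2 <= 2 * e.
  rewrite -[leRHS]mul1r ler_pM ?sqr_ge0// -real_normK ?num_real//.
  by rewrite exprn_ile1.
rewrite (_ : (z + w * r - z0) ^+ 2 = (z - z0) ^+ 2 +
  2 * ((z - z0) * w * (r - k / (s + beta))) +
  2 * (z - z0) * w / (s + beta) * k + w ^+ 2 * r ^+ 2); last by ring.
rewrite (mulrDl _ (- _)) mulNr.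
lra.
Qed.

Lemma avg_le_barrier u x y z0 a C : inS x y -> rays beta u x y -> 0 <= C ->
  0 <= z0 <= 1 ->
  (forall x y, inS x y -> u x y <= a + C * barrier z0 x y) ->
  avg u x y <= a + C * barrier z0 x y.
Proof.
move=> xyS ru C0 z01 ub; have s0 := inS_gt0 xyS.
have z1 := proportion_in01 xyS; have /andP[z1l z1r] := z1.
have sb : 0 < x + y + beta by rewrite addr_gt0.
have s2b : 0 < x + y + 2 * beta by rewrite addr_gt0// mulr_gt0.
have xE : x = x / (x + y) * (x + y) by rewrite divfK// gt_eqF.
set z := x / (x + y) in z1 z1l z1r xE *.
pose A := (z - z0) ^+ 2 + 4 * E (x + y) + 8 * beta ^+ 2 / m * (x + y + beta)^-1.
pose B w := 2 * (z - z0) * w / (x + y + beta)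
  - 8 * beta ^+ 2 / m / ((x + y + beta) * (x + y + 2 * beta)).
have step w t k b : 0 <= k <= beta -> `|w| <= 1 ->
    b = (z + w * (k / (x + y + k)) - z0) ^+ 2 + 8 * beta ^+ 2 / m * (x + y + k + beta)^-1 ->
    t <= a + C * b -> t <= (a + C * A) + C * B w * k.
  move=> kb w1 bE tb; have H : b <= A + B w * k by rewrite bE; exact: barrier_step.
  by rewrite (le_trans tb)// -(addrA a) -(mulrA C) -mulrDr lerD2l ler_wpM2l.
have := @avg_le_affine _ beta mu nu m smu snu mean_mu mean_nu u x y
  (a + C * A) (C * B (1 - z)) (a + C * A) (C * B (- z)) xyS ru.
move=> /(_ _ _)/le_trans; apply.
- move=> k kb; have /andP[k0 _] := kb; have sk : 0 < x + y + k by rewrite ltr_pwDl.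
  apply: (step _ _ _ (barrier z0 (x + k) y)) => //.
  + by rewrite ger0_norm; lra.
  + rewrite /barrier (addrAC x k y); congr ((_ - z0) ^+ 2 + _).
    by rewrite /z; field; rewrite !gt_eqF.
  + by apply: ub; exact: inS_addl.
- move=> k kb; have /andP[k0 _] := kb; have sk : 0 < x + y + k by rewrite ltr_pwDl.
  apply: (step _ _ _ (barrier z0 x (y + k))) => //.
  + by rewrite normrN ger0_norm.
  + rewrite /barrier (addrA x y k); congr ((_ - z0) ^+ 2 + _).
    by rewrite /z; field; rewrite !gt_eqF.
  + by apply: ub; exact: inS_addr.
(* Equality holds: the drifts cancel because [x * (1 - z) = y * z], and [4 * E] cancels against the
   gain of the second barrier term. *)
rewrite le_eqVlt; apply/orP; left; apply/eqP.
rewrite /barrier -/z /A /B /E /z; field.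
by rewrite !gt_eqF.
Qed.

Lemma avg_norm_le_barrier u x y z0 c a C : inS x y -> rays beta u x y -> 0 <= C ->
  0 <= z0 <= 1 ->
  (forall x y, inS x y -> `|u x y - c| <= a + C * barrier z0 x y) ->
  `|avg u x y - c| <= a + C * barrier z0 x y.
Proof.
move=> xyS ru C0 z01 ub; have [ru' E'] := avg_opp mu nu ru.
rewrite ler_norml; apply/andP; split.
- suff : avg (fun x y => - u x y) x y <= (a - c) + C * barrier z0 x y by rewrite E'; lra.
  apply: avg_le_barrier => // x' y' S'.
  by have := ub _ _ S'; rewrite ler_norml => /andP[]; lra.
- suff : avg u x y <= (a + c) + C * barrier z0 x y by lra.
  apply: avg_le_barrier => // x' y' S'.
  by have := ub _ _ S'; rewrite ler_norml => /andP[]; lra.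
Qed.

(** Averaging does not contract the barrier but does contract [expR (- s)]; this trades one for the
    other. For [s < 1 / eta] the term [B * expR (- s)] exceeds [1 / beta], and from there on [eta]
    suffices. *)
Lemma inv_le_expR (eta : R) : 0 < eta -> exists2 B, 0 <= B &
  forall s, 0 < s -> (s + beta)^-1 <= eta + B * expR (- s).
Proof.
move=> eta0; exists (beta^-1 * expR (eta^-1)).
  by rewrite mulr_ge0 ?expR_ge0// invr_ge0 ltW.
move=> s s0; have sb : 0 < s + beta by rewrite addr_gt0.
have [h|h] := leP eta^-1 s.
  apply: (@le_trans _ _ eta); last first.
    by rewrite lerDl !mulr_ge0 ?expR_ge0// invr_ge0 ltW.
  rewrite -[leRHS]invrK lef_pV2 ?posrE ?invr_gt0// (le_trans h)// lerDl ltW//.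
apply: (@le_trans _ _ beta^-1).
  by rewrite lef_pV2 ?posrE// lerDr ltW.
rewrite -mulrA -expRD (le_trans _ (_ : beta^-1 * expR (eta^-1 - s) <= _))//.
  by rewrite ler_peMr ?invr_ge0 ?(ltW beta0)// -expR0 ler_expR subr_ge0 ltW.
by rewrite lerDr ltW.
Qed.

End Dirichlet.

Section DirichletSolution.
Context {R : realType} (beta : R) (mu nu : prob R) (m : R).
Hypothesis beta0 : 0 < beta.
Hypothesis smu : supp_in beta mu.
Hypothesis snu : supp_in beta nu.
Hypothesis mean_mu : mean beta mu id = m.
Hypothesis mean_nu : mean beta nu id = m.
Hypothesis m0 : 0 < m.

Local Notation avg := (avg beta mu nu).
Local Notation harmonic_at := (harmonic_at beta mu nu).
Local Notation decay := (decay beta m).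

Variables (f : R -> R) (C : R).
Hypothesis fC : forall z, 0 <= z <= 1 -> `|f z| <= C.
Hypothesis fuc : forall e, 0 < e -> exists2 d, 0 < d & forall z z',
  0 <= z <= 1 -> 0 <= z' <= 1 -> `|z' - z| < d -> `|f z' - f z| < e.

(** Uniform continuity covers [z'] within [d] of [z]; otherwise [(z' - z) ^+ 2 / d ^+ 2 >= 1]
    absorbs the trivial bound [2 * C]. The square is the one in the barrier. *)
Let f_quadratic e : 0 < e -> exists2 K, 0 <= K & forall z z',
  0 <= z <= 1 -> 0 <= z' <= 1 -> `|f z' - f z| <= e + K * (z' - z) ^+ 2.
Proof.
move=> e0; have [d d0 H] := fuc e0.
have C0 : 0 <= C by apply: le_trans (fC (z := 0) _); rewrite ?lexx ?ler01.
exists (2 * C / d ^+ 2); first by rewrite divr_ge0 ?sqr_ge0// mulr_ge0.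
move=> z z' z1 z1'; have [zd|dz] := ltP `|z' - z| d.
  rewrite (le_trans (ltW (H _ _ z1 z1' zd)))// lerDl mulr_ge0 ?sqr_ge0//.
  by rewrite divr_ge0 ?sqr_ge0// mulr_ge0.
apply: (@le_trans _ _ (2 * C)).
  by rewrite (le_trans (ler_normB _ _))//; have := fC z1; have := fC z1'; lra.
have d2 : d ^+ 2 <= (z' - z) ^+ 2.
  by rewrite -[leRHS]real_normK ?num_real// lerXn2r ?nnegrE ?(ltW d0).
have q : 1 <= (z' - z) ^+ 2 / d ^+ 2 by rewrite ler_pdivlMr ?exprn_gt0// mul1r.
rewrite (_ : 2 * C / d ^+ 2 * _ = 2 * C * ((z' - z) ^+ 2 / d ^+ 2)); last by ring.
have C20 : 0 <= 2 * C by rewrite mulr_ge0.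
by have := ler_wpM2l C20 q; lra.
Qed.

Let u n := iter n avg (fun x y => f (x / (x + y))).

Let u_regular n : bounded_inS (u n) /\ unif_continuous_inS (u n).
Proof.
elim: n => [|n [bu ucu]]; last exact: avg_unif_continuous_inS.
split; first by exists C => x y xyS; exact/fC/proportion_in01.
move=> c e c0 e0; have [d d0 H] := fuc e0.
exists (d * c / 2); first by rewrite divr_gt0// mulr_gt0.
move=> x y x' y' S S' cs cs' xd yd; apply: H; try exact: proportion_in01.
apply: le_lt_trans (proportion_lipschitz S S' c0 cs' (ltW xd) (ltW yd)) _.
rewrite (_ : _ / c = d / 2); first by lra.
by field; rewrite gt_eqF.
Qed.

Let u_rays n x y : inS x y -> rays beta (u n) x y.
Proof.
have [bu ucu] := u_regular n => xyS.
by apply: continuous_inS_rays xyS => //; exact: unif_continuous_inSW.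
Qed.

Let u_bound n x y : inS x y -> `|u n x y| <= C.
Proof.
elim: n x y => [x y xyS|n IHn x y xyS]; first exact/fC/proportion_in01.
have := @avg_norm_le_expR _ beta mu nu m beta0 smu snu mean_mu mean_nu (u n) x y C 0.
rewrite !mul0r addr0; apply=> // [|x' y' S']; first exact: u_rays.
by rewrite mul0r addr0 IHn.
Qed.

Let u_near_start e : 0 < e -> exists2 B, 0 <= B &
  forall n x y, inS x y -> `|u n x y - u 0%N x y| <= e + B * expR (- (x + y)).
Proof.
move=> e0; have e2 : 0 < e / 2 by rewrite divr_gt0.
have [K K0 HK] := f_quadratic e2.
pose L := K * (8 * beta ^+ 2 / m).
have L0 : 0 <= L by rewrite mulr_ge0// divr_ge0 ?(ltW m0)// mulr_ge0// sqr_ge0.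
have L1 : 0 < L + 1 by rewrite ltr_wpDl.
have [B B0 HB] := inv_le_expR beta0 (divr_gt0 e2 L1).
exists (L * B); first by rewrite mulr_ge0.
move=> n x y xyS.
(* The centre [z0] stays fixed during the induction, at all points; only afterwards is it set to the
   proportion at [(x, y)], where the square in the barrier vanishes. *)
have key z0 : 0 <= z0 <= 1 -> forall x y, inS x y ->
    `|u n x y - f z0| <= e / 2 + K * barrier beta m z0 x y.
  move=> z01; elim: n => [x' y' S'|n IHn x' y' S'].
    apply: le_trans (HK _ _ z01 (proportion_in01 S')) _.
    rewrite lerD2l ler_wpM2l// lerDl mulr_ge0// ?divr_ge0 ?(ltW m0)//.
      by rewrite mulr_ge0// sqr_ge0.
    by rewrite invr_ge0 ltW// addr_gt0// inS_gt0.
  apply: (avg_norm_le_barrier beta0 smu snu mean_mu mean_nu m0) => //.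
  exact: u_rays.
apply: le_trans (key _ (proportion_in01 xyS) _ _ xyS) _.
rewrite /barrier subrr expr0n add0r mulrA -/L.
have := ler_wpM2l L0 (HB _ (inS_gt0 xyS)).
have : L * (e / 2 / (L + 1)) <= e / 2.
  rewrite mulrA ler_pdivrMr//; nra.
rewrite mulrDr mulrA; lra.
Qed.

(** The difference at [p + 1] is the average of the one at [p]: the constant [e] is preserved while
    the exponential gains a factor [decay]. So [e], then [p], can be chosen uniformly in [n]. *)
Let u_cauchy e : 0 < e -> exists2 B, 0 <= B & forall p n x y, inS x y ->
  `|u (p + n) x y - u p x y| <= e + B * decay ^+ p * expR (- (x + y)).
Proof.
move=> e0; have [B B0 HB] := u_near_start e0; exists B => //.
elim=> [n x y xyS|p IHp n x y xyS]; first by rewrite expr0 mulr1 HB.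
have E (a b : R -> R -> R) : (fun x y => a x y - b x y) = (fun x y => 1 * a x y + -1 * b x y).
  by apply/funext => s; apply/funext => t; ring.
rewrite exprSr mulrA addSn.
have -> : u (p + n).+1 x y - u p.+1 x y = avg (fun x y => u (p + n) x y - u p x y) x y.
  rewrite E avg_lincomb; [|exact: u_rays..].
  by rewrite /u /= ; ring.
apply: (avg_norm_le_expR beta0 smu snu mean_mu mean_nu) => //.
- by rewrite E; apply: rays_lincomb; exact: u_rays.
- by rewrite mulr_ge0// exprn_ge0// (decay_ge0 beta0 smu mean_mu).
- by move=> x' y' S'; exact: IHp.
Qed.

Let decay_small (B e : R) : 0 <= B -> 0 < e -> exists p, B * decay ^+ p <= e.
Proof.
move=> B0 e0; have := @cvg_decay _ beta mu m beta0 smu mean_mu m0 0 B.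
move=> /cvgrPdist_le /(_ e e0) [p _ /(_ p (leqnn p))].
rewrite sub0r normrN add0r => /(le_trans (ler_norm _)) ?; by exists p.
Qed.

Lemma dirichlet_solution : exists g : R -> R -> R,
  [/\ bounded_inS g, continuous_inS g & forall x y, inS x y -> harmonic_at g x y] /\
  [/\ forall y, 0 < y -> g 0 y = f 0, forall x, 0 < x -> g x 0 = f 1 &
    forall e, 0 < e -> exists2 M, 0 < M & forall x y, inS x y -> M <= x + y ->
      `|g x y - f (x / (x + y))| < e].
Proof.
have ucvg x y : inS x y -> cvgn (fun n => u n x y).
  move=> xyS; apply: cauchy_cvg; apply: cauchy_exP => e e0.
  have e4 : 0 < e / 4 by rewrite divr_gt0.
  have [B B0 HB] := u_cauchy e4; have [p Hp] := decay_small B0 e4.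
  exists (u p x y); exists p => // n /= pn.
  rewrite /ball/= distrC -(subnKC pn); apply: le_lt_trans (HB p _ _ _ xyS) _.
  have E1 : expR (- (x + y)) <= 1 by rewrite -expR0 ler_expR oppr_le0 ltW// inS_gt0.
  have Bp : 0 <= B * decay ^+ p.
    by rewrite mulr_ge0// exprn_ge0// (decay_ge0 beta0 smu mean_mu).
  by have := ler_wpM2l Bp E1; lra.
pose g x y := limn (fun n => u n x y).
have ug x y : inS x y -> u n x y @[n --> \oo] --> g x y by move=> /ucvg.
have gu e : 0 < e -> exists2 B, 0 <= B & forall p x y, inS x y ->
    `|g x y - u p x y| <= e + B * decay ^+ p * expR (- (x + y)).
  move=> e0; have [B B0 HB] := u_cauchy e0; exists B => // p x y xyS.
  have c : `|u n x y - u p x y| @[n --> \oo] --> `|g x y - u p x y|.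
    by apply: cvg_norm; apply: cvgB; [exact: ug|exact: cvg_cst].
  apply: (cvgr_to_le c); exists p => // n /= pn.
  by rewrite -(subnKC pn); exact: HB.
have gb : bounded_inS g.
  exists C => x y xyS; apply: (cvgr_to_le (cvg_norm (ug _ _ xyS))).
  by near=> n; exact: u_bound.
exists g; split; split => //.
- apply: unif_continuous_inSW; apply: (unif_continuous_inS_lim (u_ := u)).
    by move=> n; have [] := u_regular n.
  move=> e e0; have e2 : 0 < e / 2 by rewrite divr_gt0.
  have [B B0 HB] := gu _ e2; have [p Hp] := decay_small B0 e2.
  exists p => x y xyS; apply: le_trans (HB p _ _ xyS) _.
  have E1 : expR (- (x + y)) <= 1 by rewrite -expR0 ler_expR oppr_le0 ltW// inS_gt0.
  have Bp : 0 <= B * decay ^+ p.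
    by rewrite mulr_ge0// exprn_ge0// (decay_ge0 beta0 smu mean_mu).
  by have := ler_wpM2l Bp E1; lra.
- move=> x y xyS.
  have [rg cg] := avg_lim mu nu xyS (fun n => u_rays n xyS) u_bound ug.
  split=> //; apply: (@cvg_unique _ _ (u n.+1 x y @[n --> \oo])) => //.
  by have := ug _ _ xyS; rewrite -(cvg_shiftS (fun n => u n x y)).
(* Steps from an axis stay on it: at [x = 0] only [y] is increased, so every iterate equals [f 0]
   there. *)
- move=> y y0; have S0 t : 0 < t -> inS (0 : R) t.
    by move=> t0; split=> //; split; [exact: ltW|move=> [tE]; rewrite tE ltxx in t0].
  apply: (cvg_unique _ (ug _ _ (S0 _ y0))) => //.
  have uE n : forall t, 0 < t -> u n 0 t = f 0.
    elim: n => [t t0|n IHn t t0]; first by rewrite /u/= mul0r.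
    rewrite /u/= /avg -/(u n) mul0r !add0r.
    rewrite (@eq_mean _ _ _ _ (fun=> f 0)) ?mean_cst//.
      by rewrite mulrAC divff ?mul1r// gt_eqF.
    by move=> k /andP[k0 _]; rewrite IHn// ltr_pwDl.
  have -> : (fun n => u n 0 y) = (fun=> f 0) by apply/funext => n; exact: uE.
  exact: cvg_cst.
- move=> x x0; have S0 t : 0 < t -> inS t (0 : R).
    by move=> t0; split; [exact: ltW|split=> // -[tE]; rewrite tE ltxx in t0].
  apply: (cvg_unique _ (ug _ _ (S0 _ x0))) => //.
  have uE n : forall t, 0 < t -> u n t 0 = f 1.
    elim: n => [t t0|n IHn t t0]; first by rewrite /u/= addr0 divff ?gt_eqF.
    rewrite /u/= /avg -/(u n) mul0r !addr0.
    rewrite (@eq_mean _ _ _ _ (fun=> f 1)) ?mean_cst//.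
      by rewrite mulrAC divff ?mul1r// gt_eqF.
    by move=> k /andP[k0 _]; rewrite IHn// ltr_pwDl.
  have -> : (fun n => u n x 0) = (fun=> f 1) by apply/funext => n; exact: uE.
  exact: cvg_cst.
- move=> e e0; have e2 : 0 < e / 2 by rewrite divr_gt0.
  have [B B0 HB] := gu _ e2.
  (* [expR s >= 1 + s] turns this threshold into [B * expR (- s) < e / 2]. *)
  exists (2 * (B + 1) / e); first by rewrite divr_gt0// mulr_gt0// ltr_wpDl.
  move=> x y xyS xyM; apply: le_lt_trans (HB 0%N _ _ xyS) _.
  rewrite expr0 mulr1 expRN.
  have s0 := inS_gt0 xyS; have b1 : 0 < B + 1 by rewrite ltr_wpDl.
  suff : B / expR (x + y) < e / 2 by lra.
  rewrite ltr_pdivrMr ?expR_gt0//.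
  have := expR_ge1Dx (x + y) => h; rewrite ler_pdivrMr// in xyM.
  nra.
Unshelve. all: by end_near. Qed.

End DirichletSolution.

(** * From scalar functions to measures *)

Section MeasureEquation.
Context {R : realType} (beta : R) (mu nu : prob R).
Hypothesis smu : supp_in beta mu.
Hypothesis snu : supp_in beta nu.

Local Notation avg := (avg beta mu nu).
Local Notation harmonic_at := (harmonic_at beta mu nu).

Lemma intF_norm (P : prob R) t : supp_in 1 P -> `|intF P t| <= `|t|.
Proof.
move=> sP; have [t0|t0] := leP t 0; first by rewrite intF_le0// normr0.
have := intF_slope sP (ltW t0); rewrite (intF_le0 P (lexx 0)) !subr0 => /andP[j0 j1].
by rewrite !ger0_norm// ltW.
Qed.

Lemma difference_quotient (P : prob R) t n : supp_in 1 P ->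
  distF P t <= n.+1%:R * (intF P (t + n.+1%:R^-1) - intF P t)
    <= distF P (t + n.+1%:R^-1).
Proof.
move=> sP; have n0 : 0 < n.+1%:R :> R by [].
have ni0 : 0 <= n.+1%:R^-1 :> R by rewrite invr_ge0.
by have := intF_sandwich t sP ni0; rewrite ler_pdivrMr// ler_pdivlMr// ![_ * n.+1%:R]mulrC.
Qed.

Lemma difference_quotient_cvg (P : prob R) t : supp_in 1 P ->
  n.+1%:R * (intF P (t + n.+1%:R^-1) - intF P t) @[n --> \oo] --> distF P t.
Proof.
move=> sP; apply: (squeeze_cvgr _ (cvg_cst _) (@distF_right _ P t)).
by near=> n; exact: difference_quotient.
Unshelve. all: by end_near. Qed.

Lemma riemann_sum_bound (P : prob R) (h : R) k : supp_in 1 P -> 0 <= h ->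
  0 <= intF P (k%:R * h) - \sum_(i < k) h * distF P (i%:R * h) <= h.
Proof.
move=> sP h0.
suff : 0 <= intF P (k%:R * h) - \sum_(i < k) h * distF P (i%:R * h)
    <= h * (distF P (k%:R * h) - distF P 0).
  move=> /andP[-> /le_trans]; apply; rewrite ler_piMr//.
  by have := distF_le1 P (k%:R * h); have := distF_ge0 P 0; lra.
elim: k => [|k IHk].
  by rewrite big_ord0 mul0r intF_le0// !subrr mulr0 lexx.
rewrite big_ord_recr/=.
have -> : k.+1%:R * h = k%:R * h + h by rewrite -natr1 mulrDl mul1r.
move: IHk; have := intF_sandwich (k%:R * h) sP h0; lra.
Qed.

Variable G : R -> R -> prob R.
Hypothesis sG : forall x y, inS x y -> supp_in 1 (G x y).

Lemma quotient_norm1 t n x y : inS x y ->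
  `|n.+1%:R * intF (G x y) (t + n.+1%:R^-1) + - n.+1%:R * intF (G x y) t| <= 1.
Proof.
move=> xyS; rewrite mulNr -mulrBr.
have /andP[a b] := difference_quotient t n (sG xyS).
rewrite ger0_norm ?(le_trans b) ?distF_le1//.
by rewrite (le_trans _ a) ?distF_ge0.
Qed.

Lemma quotient_cvg t x y : inS x y ->
  n.+1%:R * intF (G x y) (t + n.+1%:R^-1) + - n.+1%:R * intF (G x y) t
    @[n --> \oo] --> distF (G x y) t.
Proof.
move=> xyS; under eq_fun do rewrite mulNr -mulrBr.
exact: difference_quotient_cvg (sG xyS).
Qed.

(** Measurability of [distF (G x y) t] in the increment is inherited from the difference quotients
    of [intF], which lie in [[0, 1]]. *)
Lemma rays_distF x y : inS x y ->
  (forall t, rays beta (fun x y => intF (G x y) t) x y) ->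
  forall t, rays beta (fun x y => distF (G x y) t) x y.
Proof.
move=> xyS rJ t.
have rq n := rays_lincomb n.+1%:R (- n.+1%:R) (rJ (t + n.+1%:R^-1)) (rJ t).
by have [] := avg_lim mu nu xyS rq (quotient_norm1 t) (@quotient_cvg t).
Qed.

Lemma harmonic_distF x y : inS x y ->
  (forall t, harmonic_at (fun x y => intF (G x y) t) x y) ->
  forall t, harmonic_at (fun x y => distF (G x y) t) x y.
Proof.
move=> xyS hJ t.
have hq n := harmonic_at_lincomb n.+1%:R (- n.+1%:R) (hJ (t + n.+1%:R^-1)) (hJ t).
exact: harmonic_at_lim xyS hq (quotient_norm1 t) (@quotient_cvg t).
Qed.

Lemma harmonic_at_sum (u : nat -> R -> R -> R) (c : R) k x y : inS x y ->
  (forall i, harmonic_at (u i) x y) ->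
  harmonic_at (fun x y => \sum_(i < k) c * u i x y) x y.
Proof.
move=> xyS hu; elim: k => [|k IHk].
  apply: (eq_harmonic_at (u := fun _ _ => 0) xyS) => [x' y' _|].
    by rewrite big_ord0.
  exact: harmonic_at_cst.
apply: (eq_harmonic_at xyS _ (harmonic_at_lincomb 1 c IHk (hu k))) => x' y' _.
by rewrite big_ord_recr/= mul1r.
Qed.

(** Left Riemann sums of [distF] are finite linear combinations of harmonic functions, and differ
    from [intF] by at most the mesh because [distF] grows by at most 1 in all. *)
Lemma harmonic_intF x y : inS x y ->
  (forall t, harmonic_at (fun x y => distF (G x y) t) x y) ->
  forall t, harmonic_at (fun x y => intF (G x y) t) x y.
Proof.
move=> xyS hF t; have [t0|/ltW t0] := leP t 0.
  apply: (eq_harmonic_at (u := fun _ _ => 0) xyS) => [x' y' _|].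
    by rewrite intF_le0.
  exact: harmonic_at_cst.
pose h n : R := t / n.+1%:R.
have h0 n : 0 <= h n by rewrite divr_ge0.
have hE n : n.+1%:R * h n = t by rewrite mulrC divfK.
have hle n : h n <= t by rewrite ler_pdivrMr// ler_peMr// ler1n.
have rs n x' y' : inS x' y' ->
    0 <= intF (G x' y') t - \sum_(i < n.+1) h n * distF (G x' y') (i%:R * h n) <= h n.
  by move=> S'; have := riemann_sum_bound n.+1 (sG S') (h0 n); rewrite hE.
apply: (harmonic_at_lim (u_ := fun n x y => \sum_(i < n.+1) h n * distF (G x y) (i%:R * h n))
  (C := t + t) xyS).
- by move=> n; apply: (harmonic_at_sum (u := fun i x y => distF (G x y) (i%:R * h n))).
- move=> n x' y' S'; have /andP[a b] := rs n _ _ S'.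
  have := intF_norm t (sG S'); rewrite (ger0_norm t0) ler_norml => /andP[c d].
  by have := hle n; rewrite ler_norml; move=> ?; apply/andP; split; lra.
- move=> x' y' S'; apply/cvgrPdist_le => e e0; near=> n.
  have /andP[a b] := rs n _ _ S'; rewrite ger0_norm// (le_trans b)//.
  rewrite ler_pdivrMr// mulrC -ler_pdivrMr//.
  apply: (@le_trans _ _ n%:R); last by rewrite ler_nat.
  by near: n; exact: nbhs_infty_ger.
Unshelve. all: by end_near. Qed.

(** The sets with a harmonic probability form a Dynkin class: complements by linearity, disjoint
    unions by bounded limits, the partial sums being probabilities of finite unions. *)
Lemma harmonic_measure x y : inS x y ->
  (forall t, harmonic_at (fun x y => distF (G x y) t) x y) ->
  forall A, measurable A -> harmonic_at (fun x y => fine (G x y A)) x y.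
Proof.
move=> xyS hF A mA; have := mA; rewrite generated_itvoy => sA.
have compl S : measurable S -> harmonic_at (fun x y => fine (G x y S)) x y ->
    harmonic_at (fun x y => fine (G x y (~` S))) x y.
  move=> mS hS; have h1 := harmonic_at_cst smu snu 1 xyS.
  apply: (eq_harmonic_at xyS _ (harmonic_at_lincomb 1 (-1) h1 hS)) => x' y' _.
  rewrite probability_setC// fineB ?fin_num_measure//= mul1r; lra.
apply: (@dynkin_induction _ _ _ (fun A => harmonic_at (fun x y => fine (G x y A)) x y)
  generated_itvoy itvoy_setI_closed _ _ _ _ _ sA).
- apply: (eq_harmonic_at (u := fun _ _ => 1) xyS) => [x' y' _|].
    by rewrite probability_setT.
  exact: harmonic_at_cst.
- by move=> _ [t ->]; rewrite -setCitvl; apply: compl => //; exact: hF.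
- by move=> S mS; exact: compl.
- move=> F mF tF hFn.
  pose u n x y := \sum_(i < n) 1 * fine (G x y (F i)).
  have uE n x' y' : (u n x' y')%:E = (\sum_(0 <= i < n) G x' y' (F i))%E.
    rewrite /u -sumEFin big_mkord; apply: eq_bigr => i _.
    by rewrite mul1r fineK// fin_num_measure.
  have u0 n x' y' : 0 <= u n x' y' by apply: sumr_ge0 => i _; rewrite mul1r fine_ge0.
  apply: (harmonic_at_lim (u_ := u) (C := 1) xyS).
  + by move=> n; apply: (harmonic_at_sum (u := fun i x y => fine (G x y (F i)))).
  + move=> n x' y' S'; rewrite ger0_norm// -lee_fin uE.
    rewrite big_mkord -measure_bigsetU//.
    by apply: probability_le1; apply: bigsetU_measurable => i _; exact: mF.
  + move=> x' y' S'; have mU : measurable (\bigcup_k F k) by exact: bigcup_measurable.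
    have H : (u n x' y')%:E @[n --> \oo] --> (fine (G x' y' (\bigcup_k F k)))%:E.
      rewrite fineK ?fin_num_measure//.
      have -> : (fun n => (u n x' y')%:E) = (fun n => \sum_(0 <= i < n) G x' y' (F i))%E.
        by apply/funext => n; exact: uE.
      exact: measure_semi_sigma_additive.
    exact: (fine_cvg H).
Qed.

Lemma solution_equation x y A : inS x y -> measurable A ->
  rays beta (fun x y => fine (G x y A)) x y ->
  ((x%:E * \int[mu]_(k in `[0%R, beta]%classic) (G x y A - G (x + k)%R y A)) +
   (y%:E * \int[nu]_(k in `[0%R, beta]%classic) (G x y A - G x (y + k)%R A)) = 0)%E
  <-> fine (G x y A) = avg (fun x y => fine (G x y A)) x y.
Proof.
move=> xyS mA [r1 r2]; have s0 := inS_gt0 xyS.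
set a := fine (G x y A).
have intE (P : prob R) (sP : supp_in beta P) (H : R -> prob R) :
    bounded_mfun beta (fun k => fine (H k A)) ->
    (\int[P]_(k in `[0%R, beta]%classic) (G x y A - H k A))%E =
    (a - mean beta P (fun k => fine (H k A)))%:E.
  move=> bH; have bc := bounded_mfun_cst beta a.
  have E : (fun k => a - fine (H k A)) = (fun k => 1 * (fun=> a) k + -1 * fine (H k A)).
    by apply/funext => k; rewrite mul1r mulN1r.
  have -> : a - mean beta P (fun k => fine (H k A)) = mean beta P (fun k => a - fine (H k A)).
    by rewrite E mean_lincomb// mean_cst// mul1r mulN1r.
  rewrite EFin_mean; last first.
    by rewrite E; apply: bounded_mfunD; exact: bounded_mfunZ.
  by apply: eq_integral => k _; rewrite EFinB !fineK// fin_num_measure.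
rewrite (intE _ smu (fun k => G (x + k) y) r1) (intE _ snu (fun k => G x (y + k)) r2).
rewrite /avg; set M1 := mean _ _ _; set M2 := mean _ _ _.
rewrite -!EFinM -EFinD; split.
  move=> [] H; apply: (@mulIf _ (x + y)); first by rewrite gt_eqF.
  by rewrite divfK ?gt_eqF//; lra.
move=> aE; congr EFin; have : a * (x + y) = x * M1 + y * M2.
  by rewrite aE divfK// gt_eqF.
lra.
Qed.

End MeasureEquation.

(** * Uniqueness, stability and existence for measures *)

Section Solutions.
Context {R : realType}.

Lemma unit_interval_unif_continuous (f : R -> R) :
  (forall t, 0 <= t <= 1 -> forall e, 0 < e -> exists2 d, 0 < d &
    forall s, 0 <= s <= 1 -> `|s - t| < d -> `|f s - f t| < e) ->
  forall e, 0 < e -> exists2 d, 0 < d & forall z z',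
    0 <= z <= 1 -> 0 <= z' <= 1 -> `|z' - z| < d -> `|f z' - f z| < e.
Proof.
move=> cf e e0.
pose P (d x : R) := 0 <= x <= 1 -> forall y, 0 <= y <= 1 -> `|y - x| < d ->
  `|f y - f x| < e.
have H : \forall d \near 0^'+, `[0, 1]%classic `<=` P d.
  apply: (compact_near_coveringP _).1; first exact: segment_compact.
  move=> x; rewrite /= in_itv/= => x01.
  have [d d0 Hd] := cf x x01 _ (divr_gt0 e0 (ltr0Sn _ 1)).
  have d2 : 0 < d / 2 by rewrite divr_gt0.
  exists (ball x (d / 2), [set r | r < d / 2]); first split => /=.
  - exact: (@nbhsx_ballx _ R^o x _ d2).
  - exact: nbhs_right_lt.
  move=> [x' r] /= [xx' rd] x'01 y y01 yx'.
  have xx : `|x' - x| < d / 2 by rewrite distrC.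
  have yx : `|y - x| < d.
    have := ler_normD (y - x') (x' - x); rewrite addrA subrK; lra.
  have h1 := Hd _ y01 yx; have h2 : `|f x' - f x| < e / 2 by apply: Hd => //; lra.
  have := ler_normB (f y - f x) (f x' - f x).
  rewrite [X in `|X| <= _](_ : _ = f y - f x'); last by ring.
  lra.
have [d [d0 Hd]] : exists d, 0 < d /\ `[0, 1]%classic `<=` P d.
  apply: (@filter_ex _ (0 : R)^'+).
  by near=> d; split; near: d; [exact: nbhs_right_gt|exact: H].
by exists d => // z z' z01 z'01 zz'; apply: Hd.
Unshelve. all: by end_near. Qed.

Lemma dW_sym b (P Q : prob R) : dW b P Q = dW b Q P.
Proof. by apply: eq_Rintegral => t _; rewrite distrC. Qed.

Lemma dW_le_d_infty (phi psi : R -> prob R) z : 0 <= z <= 1 ->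
  dW 1 (phi z) (psi z) <= d_infty phi psi.
Proof.
move=> z01; apply: ub_le_sup; last by exists z.
by exists 1 => _ [t [_ ->]]; exact: dW_le1.
Qed.

Lemma dC_le (G G0 : R -> R -> prob R) e : 0 <= e ->
  (forall x y, inS x y -> dW 1 (G x y) (G0 x y) <= e) -> dC G G0 <= e.
Proof.
move=> e0 GG.
(* The point [(1, 0)] makes each set whose supremum is [d_n] nonempty, including [n = 0], where the
   inverse is 0. *)
have S10 : inS (1 : R) 0 by split; [|split=> //; move=> [/eqP]; rewrite oner_eq0].
have n1 n : n%:R^-1 <= 1 + 0 :> R.
  case: n => [|n]; first by rewrite invr0 addr0.
  by rewrite addr0 invf_le1// ler1n.
have dn0 n : 0 <= d_n n G G0.
  apply: le_trans (dW_ge0 1 (G 1 0) (G0 1 0)) _; apply: ub_le_sup.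
    by exists 1 => _ [x [y [_ [_ ->]]]]; exact: dW_le1.
  by exists 1, 0; split.
have dne n : d_n n G G0 <= e.
  apply: ge_sup; first by exists (dW 1 (G 1 0) (G0 1 0)), 1, 0.
  by move=> _ [x [y [xyS [_ ->]]]]; exact: GG.
have t0 n : 0 <= 2%:R ^- n * (d_n n G G0 / (1 + d_n n G G0)).
  by rewrite mulr_ge0 ?invr_ge0 ?exprn_ge0// divr_ge0// addr_ge0.
have te n : 2%:R ^- n * (d_n n G G0 / (1 + d_n n G G0)) <= 2%:R ^- n * e.
  rewrite ler_wpM2l ?invr_ge0 ?exprn_ge0// (le_trans _ (dne n))//.
  by rewrite ler_pdivrMr ?ltr_pwDl// ler_peMr// lerDl.
pose S N := \sum_(1 <= n < N) (2%:R ^- n * (d_n n G G0 / (1 + d_n n G G0))).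
have Se N : S N <= e.
  case: N => [|N]; first by rewrite /S big_geq.
  (* The range of [S N.+1] stops at [N], and the dyadic weights from 1 to [N] sum to
     [1 - 2 ^- N]. *)
  suff : S N.+1 <= e * (1 - 2%:R ^- N).
    by move=> /le_trans; apply; rewrite ler_piMr// gerBl invr_ge0 exprn_ge0.
  elim: N => [|N IHN]; first by rewrite /S big_geq// expr0 invr1 subrr mulr0.
  rewrite /S big_nat_recr//= -/(S N.+1).
  have -> : e * (1 - 2%:R ^- N.+1) = e * (1 - 2%:R ^- N) + 2%:R ^- N.+1 * e.
    by rewrite exprS; field; rewrite expf_neq0.
  exact: lerD.
have Sc : cvgn S.
  apply: nondecreasing_is_cvgn; last by exists e => _ [N _ <-].
  apply/nondecreasing_seqP => N; case: N => [|N]; first by rewrite /S !big_geq.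
  by rewrite {2}/S big_nat_recr//= lerDl.
by apply: limr_le => //; near=> N; exact: Se.
Unshelve. all: by end_near. Qed.

Lemma list_uniform (T : eqType) (Q : R -> T -> Prop) (ts : seq T) :
  (forall t d d', 0 < d' -> d' <= d -> Q d t -> Q d' t) ->
  (forall t, exists2 d, 0 < d & Q d t) ->
  exists2 d, 0 < d & forall t, t \in ts -> Q d t.
Proof.
move=> Qm Qe; elim: ts => [|t ts [d d0 IH]]; first by exists 1.
have [d' d'0 Qt] := Qe t; have m0 : 0 < Num.min d d' by rewrite lt_min d0.
exists (Num.min d d') => // s; rewrite inE => /orP[/eqP->|/IH].
  by apply: Qm Qt => //; rewrite ge_min lexx orbT.
by apply: Qm => //; rewrite ge_min lexx.
Qed.

Context (beta : R) (mu nu : prob R) (m : R).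
Hypothesis beta0 : 0 < beta.
Hypothesis smu : supp_in beta mu.
Hypothesis snu : supp_in beta nu.
Hypothesis mean_mu : mean beta mu id = m.
Hypothesis mean_nu : mean beta nu id = m.
Hypothesis m0 : 0 < m.

Lemma contS_intF (G : R -> R -> prob R) t : contS G ->
  bounded_inS (fun x y => intF (G x y) t) /\
  continuous_inS (fun x y => intF (G x y) t).
Proof.
move=> [sG cG]; split.
  by exists `|t| => x y xyS; apply: intF_norm; exact: sG.
move=> x y xyS e e0; have [d d0 H] := cG x y xyS e e0.
exists d => // x' y' S' xd yd; apply: le_lt_trans (H _ _ S' xd yd).
by apply: intF_dist; exact: sG.
Qed.

(** The equation is given for sets inside [[0, 1]], so it is tested on half-lines cut to [[0, 1]].
    Continuity of [intF] first supplies integrability; the equation for [distF] then integrates to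
    one for [intF]. *)
Lemma solves_harmonic phi (G : R -> R -> prob R) t : solves beta mu nu phi G ->
  forall x y, inS x y -> harmonic_at beta mu nu (fun x y => intF (G x y) t) x y.
Proof.
move=> [cG [eqG _]] x y xyS; have [sG _] := cG.
apply: harmonic_intF => // {}t.
have rF : rays beta (fun x y => distF (G x y) t) x y.
  apply: (rays_distF mu nu) => // s; have [bJ cJ] := contS_intF s cG.
  exact: continuous_inS_rays.
pose A : set R := `]-oo, t]%classic `&` `[0, 1]%classic.
have mA : measurable A by exact: measurableI.
have AE x' y' : inS x' y' -> distF (G x' y') t = fine (G x' y' A).
  by move=> S'; rewrite /distF (supp_in_setI (sG _ _ S')).
have rA := eq_rays xyS AE rF.
have hA := (solution_equation smu snu xyS mA rA).1
  (eqG x y xyS A mA (@subIsetr _ _ _)).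
apply: (eq_harmonic_at xyS (fun x' y' S' => esym (AE x' y' S'))).
by split.
Qed.

(** Far out each solution is within [e / 2] of its datum, so the difference is at most [d + e] there
    and, by the maximum principle, everywhere. [d = 0] yields uniqueness, small [d] continuous
    dependence. *)
Lemma intF_solutions_le phi phi0 G G0 d t : boundary_datum phi -> boundary_datum phi0 ->
  solves beta mu nu phi G -> solves beta mu nu phi0 G0 ->
  (forall z, 0 <= z <= 1 -> dW 1 (phi z) (phi0 z) <= d) ->
  forall x y, inS x y -> intF (G x y) t - intF (G0 x y) t <= d.
Proof.
move=> [sphi _] [sphi0 _] hG hG0 dphi x y xyS.
apply/ler_addgt0Pr => e e0; have e2 : 0 < e / 2 by rewrite divr_gt0.
have [cG [_ [_ [_ aG]]]] := hG; have [cG0 [_ [_ [_ aG0]]]] := hG0.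
have [M HM] := aG _ e2; have [M0 HM0] := aG0 _ e2.
suff : 1 * intF (G x y) t + -1 * intF (G0 x y) t <= d + e by rewrite mul1r mulN1r.
apply: (@harmonic_le _ beta mu nu m beta0 smu snu mean_mu mean_nu m0
  (fun x y => 1 * intF (G x y) t + -1 * intF (G0 x y) t) (`|t| + `|t|) (Num.max M M0)) xyS.
- move=> x' y' S'; apply: harmonic_at_lincomb.
    exact: (solves_harmonic t hG).
  exact: (solves_harmonic t hG0).
- move=> x' y' S'; have := intF_norm t (cG.1 _ _ S'); have := intF_norm t (cG0.1 _ _ S').
  rewrite !ler_norml => /andP[? ?] /andP[? ?]; lra.
- move=> x' y' S'; rewrite ge_max => /andP[Ms Ms0].
  have z01 := proportion_in01 S'.
  have := le_lt_trans (intF_dist t (cG.1 _ _ S') (sphi _ z01)) (HM _ _ S' Ms).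
  have := le_lt_trans (intF_dist t (cG0.1 _ _ S') (sphi0 _ z01)) (HM0 _ _ S' Ms0).
  have := le_trans (intF_dist t (sphi _ z01) (sphi0 _ z01)) (dphi _ z01).
  rewrite ler_norml !ltr_norml => /andP[? ?] /andP[? ?] /andP[? ?]; lra.
Qed.

Lemma intF_solutions_dist phi phi0 G G0 d t : boundary_datum phi -> boundary_datum phi0 ->
  solves beta mu nu phi G -> solves beta mu nu phi0 G0 ->
  (forall z, 0 <= z <= 1 -> dW 1 (phi z) (phi0 z) <= d) ->
  forall x y, inS x y -> `|intF (G x y) t - intF (G0 x y) t| <= d.
Proof.
move=> bphi bphi0 hG hG0 dphi x y xyS; rewrite ler_norml lerNl opprB.
rewrite (intF_solutions_le t bphi bphi0 hG hG0 dphi xyS) andbT.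
apply: (intF_solutions_le t bphi0 bphi hG0 hG) => // z z01.
by rewrite dW_sym dphi.
Qed.

Lemma solution_exists phi : boundary_datum phi -> exists G, solves beta mu nu phi G.
Proof.
move=> [sphi cphi].
have /choice[g hg] : forall t, exists gt : R -> R -> R,
  [/\ bounded_inS (gt), continuous_inS (gt) &
    forall x y, inS x y -> harmonic_at beta mu nu (gt) x y] /\
  [/\ forall y, 0 < y -> gt 0 y = intF (phi 0) t,
    forall x, 0 < x -> gt x 0 = intF (phi 1) t &
    forall e, 0 < e -> exists2 M, 0 < M & forall x y, inS x y -> M <= x + y ->
      `|gt x y - intF (phi (x / (x + y))) t| < e].
  move=> t.
  apply: (dirichlet_solution beta0 smu snu mean_mu mean_nu m0
    (f := fun z => intF (phi z) t) (C := `|t|)).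
    by move=> z z01; apply: intF_norm; exact: sphi.
  apply: unit_interval_unif_continuous => z z01 e e0.
  have [d d0 Hd] := cphi z z01 e e0; exists d => // s s01 sz.
  by apply: le_lt_trans (Hd s s01 sz); apply: intF_dist; exact: sphi.
(* Transports linear inequalities among three values of [intF] from the datum to [g]. Shorter
   relations are padded with zero coefficients, equalities split into two inequalities. *)
have principle t1 t2 t3 a1 a2 a3 c : (forall z, 0 <= z <= 1 ->
      a1 * intF (phi z) t1 + (a2 * intF (phi z) t2 + a3 * intF (phi z) t3) <= c) ->
    forall x y, inS x y -> a1 * g t1 x y + (a2 * g t2 x y + a3 * g t3 x y) <= c.
  move=> Hc x y xyS; apply/ler_addgt0Pr => e e0.
  have [[[C1 b1] _ h1] [_ _ l1]] := hg t1.
  have [[[C2 b2] _ h2] [_ _ l2]] := hg t2.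
  have [[[C3 b3] _ h3] [_ _ l3]] := hg t3.
  have small (a : R) : exists2 r, 0 < r & `|a| * r <= e / 3.
    exists (e / 3 / (`|a| + 1)); first by rewrite !divr_gt0// ltr_wpDl.
    rewrite mulrCA ler_piMr ?divr_ge0 ?(ltW e0)//.
    by rewrite ler_pdivrMr ?ltr_wpDl// mul1r lerDl.
  have [r1 r10 R1] := small a1; have [r2 r20 R2] := small a2.
  have [r3 r30 R3] := small a3.
  have [M1 _ H1] := l1 _ r10; have [M2 _ H2] := l2 _ r20; have [M3 _ H3] := l3 _ r30.
  have bnd (a u C : R) : `|u| <= C -> a * u <= `|a| * C.
    by move=> uC; rewrite (le_trans (ler_norm _))// normrM ler_wpM2l.
  suff : a1 * g t1 x y + 1 * (a2 * g t2 x y + a3 * g t3 x y) <= c + e by rewrite mul1r.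
  apply: (@harmonic_le _ beta mu nu m beta0 smu snu mean_mu mean_nu m0
    (fun x y => a1 * g t1 x y + 1 * (a2 * g t2 x y + a3 * g t3 x y))
    (`|a1| * C1 + (`|a2| * C2 + `|a3| * C3)) (Num.max M1 (Num.max M2 M3))) xyS.
  - move=> x' y' S'; apply: harmonic_at_lincomb; first exact: h1.
    by apply: harmonic_at_lincomb; [exact: h2|exact: h3].
  - move=> x' y' S'; rewrite mul1r.
    by apply: lerD; [|apply: lerD]; apply: bnd; [exact: b1|exact: b2|exact: b3].
  - move=> x' y' S'; rewrite !ge_max mul1r => /and3P[s1 s2 s3].
    have := Hc _ (proportion_in01 S').
    have := bnd a1 _ _ (ltW (H1 _ _ S' s1)).
    have := bnd a2 _ _ (ltW (H2 _ _ S' s2)).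
    have := bnd a3 _ _ (ltW (H3 _ _ S' s3)).
    lra.
have /choice[G hG] : forall p : R * R, exists P : prob R, inS p.1 p.2 ->
    supp_in 1 P /\ forall t, intF P t = g t p.1 p.2.
  move=> [x y] /=.
  have [xyS|nS] := pselect (inS x y); last by exists (phi 0).
  suff [P HP] : exists P : prob R, supp_in 1 P /\ forall t, intF P t = g t x y.
    by exists P.
  apply: (@intF_surjective _ (fun t => g t x y)).
  - move=> t t0; apply/eqP; rewrite eq_le; apply/andP; split.
      have := @principle t t t 1 0 0 0 _ x y xyS; rewrite !mul0r !addr0 mul1r; apply.
      by move=> z z01; rewrite intF_le0// mulr0 !mul0r !addr0.
    have := @principle t t t (-1) 0 0 0 _ x y xyS; rewrite !mul0r !addr0 mulN1r oppr_le0; apply.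
    by move=> z z01; rewrite intF_le0// mulr0 !mul0r !addr0.
  - move=> t t1.
    have := @principle t 1 1 1 (-1) 0 (t - 1) _ x y xyS.
    have := @principle t 1 1 (-1) 1 0 (1 - t) _ x y xyS.
    move=> h1 h2; apply/eqP; rewrite eq_le; apply/andP; split.
      have -> : g t x y = 1 * g t x y + (-1 * g 1 x y + 0 * g 1 x y) + g 1 x y by ring.
      rewrite addrC lerD2l; apply: h2 => z z01.
      by rewrite (intF_ge1 (sphi _ z01) t1); lra.
    have h : -1 * g t x y + (1 * g 1 x y + 0 * g 1 x y) <= 1 - t.
      by apply: h1 => z z01; rewrite (intF_ge1 (sphi _ z01) t1); lra.
    by lra.
  - move=> a b c ab bc.
    have := @principle a b c (- (c - b)) ((c - b) + (b - a)) (- (b - a)) 0 _ x y xyS.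
    move=> h; rewrite -subr_le0 [leLHS](_ : _ = - (c - b) * g a x y +
      ((c - b + (b - a)) * g b x y + - (b - a) * g c x y)); last by ring.
    apply: h => z z01; have := intF_convex (sphi _ z01) ab bc; lra.
  - move=> a b ab; apply/andP; split.
      have h : 1 * g a x y + (-1 * g b x y + 0 * g b x y) <= 0.
        by apply: principle xyS => z z01; have /andP[] := intF_slope (sphi _ z01) ab; lra.
      lra.
    have h : -1 * g a x y + (1 * g b x y + 0 * g b x y) <= b - a.
      by apply: principle xyS => z z01; have /andP[] := intF_slope (sphi _ z01) ab; lra.
    lra.
pose H x y := G (x, y).
have sH x y : inS x y -> supp_in 1 (H x y) by move=> xyS; have [] := hG (x, y) xyS.
have JH x y t : inS x y -> intF (H x y) t = g t x y.
  by move=> xyS; have [_ ->] := hG (x, y) xyS.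
have hJ x y : inS x y -> forall t, harmonic_at beta mu nu (fun x y => intF (H x y) t) x y.
  move=> xyS t; have [[_ _ h] _] := hg t.
  by apply: (eq_harmonic_at xyS _ (h _ _ xyS)) => x' y' S'; rewrite JH.
have in0 : 0 <= (0 : R) <= 1 by rewrite lexx ler01.
have in1 : 0 <= (1 : R) <= 1 by rewrite lexx ler01.
exists H; split; [split=> // x y xyS e e0|split; [|split; [|split]]].
- have [ts [d d0 Hd]] := dW_small e0.
  have [r r0 Hr] : exists2 r, 0 < r & forall t, t \in ts -> forall x' y', inS x' y' ->
      `|x' - x| < r -> `|y' - y| < r -> `|g t x' y' - g t x y| < d.
    apply: list_uniform => [t r r' r'0 r'r Q x' y' S' xr yr|t].
      by apply: Q => //; [exact: lt_le_trans xr r'r|exact: lt_le_trans yr r'r].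
    by have [[_ c _] _] := hg t; have [r r0 Hr] := c _ _ xyS _ d0; exists r.
  exists r => // x' y' S' xr yr; apply: Hd; [exact: sH|exact: sH|].
  by move=> t tts; rewrite !JH//; apply/ltW/Hr.
- move=> x y xyS A mA _.
  have [rA aA] := harmonic_measure smu snu xyS (harmonic_distF sH xyS (hJ _ _ xyS)) mA.
  exact: (solution_equation smu snu xyS mA rA).2.
- move=> y y0; have S0 : inS (0 : R) y.
    by split=> //; split; [exact: ltW|move=> [yE]; rewrite yE ltxx in y0].
  apply: intF_meq => [||t]; [exact: sH|exact: sphi|].
  by rewrite JH//; have [_ [-> //]] := hg t.
- move=> x x0; have S0 : inS x (0 : R).
    by split; [exact: ltW|split=> // -[xE]; rewrite xE ltxx in x0].
  apply: intF_meq => [||t]; [exact: sH|exact: sphi|].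
  by rewrite JH//; have [_ [_ ->]] := hg t.
- move=> e e0; have [ts [d d0 Hd]] := dW_small e0.
  (* The threshold is written [r^-1] so that shrinking [r] weakens the claim, as [list_uniform]
     requires. *)
  have [r r0 Hr] : exists2 r, 0 < r & forall t, t \in ts -> forall x y, inS x y ->
      r^-1 <= x + y -> `|g t x y - intF (phi (x / (x + y))) t| < d.
    apply: list_uniform => [t r r' r'0 r'r Q x y xyS xyr|t].
      apply: Q => //; apply: le_trans xyr.
      by rewrite lef_pV2 ?posrE// (lt_le_trans r'0).
    have [_ [_ _ l]] := hg t; have [M M0 HM] := l _ d0.
    by exists M^-1; [rewrite invr_gt0|rewrite invrK].
  exists r^-1 => x y xyS xyr; apply: Hd; [exact: sH|exact/sphi/proportion_in01|].
  by move=> t tts; rewrite JH//; apply/ltW/Hr.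
Qed.

End Solutions.

Theorem theorem2p1 (R : realType) (m0 beta : R) (hm0 : 0 < m0) (hmb : m0 <= beta)
  (mu nu : prob R) (hmu : supp_in beta mu) (hnu : supp_in beta nu)
  (hmean : (\int[mu]_(k in `[0%R, beta]%classic) k%:E = \int[nu]_(k in `[0%R, beta]%classic) k%:E)%E)
  (hm0mean : (m0%:E <= \int[mu]_(k in `[0%R, beta]%classic) k%:E)%E) :
  (forall phi : R -> prob R, boundary_datum phi ->
     (exists G, solves beta mu nu phi G) /\
     (forall G1 G2, solves beta mu nu phi G1 -> solves beta mu nu phi G2 ->
        forall x y, inS x y -> meq (G1 x y) (G2 x y))) /\
  (forall phi0 : R -> prob R, boundary_datum phi0 ->
     forall e : R, 0 < e -> exists2 delta : R, 0 < delta &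
       forall phi : R -> prob R, boundary_datum phi -> d_infty phi phi0 < delta ->
         forall G G0, solves beta mu nu phi G -> solves beta mu nu phi0 G0 ->
           dC G G0 < e).
Proof.
have beta0 : 0 < beta by exact: lt_le_trans hm0 hmb.
have bid := bounded_mfun_id beta.
have mE : mean beta nu id = mean beta mu id.
  by apply: EFin_inj; rewrite !EFin_mean// -hmean.
have m0' : 0 < mean beta mu id.
  by apply: lt_le_trans hm0 _; rewrite -lee_fin EFin_mean.
split=> [phi bphi|phi0 bphi0 e e0].
  split; first exact: (solution_exists beta0 hmu hnu erefl mE m0').
  move=> G1 G2 h1 h2 x y xyS.
  apply: intF_meq => [||t]; [by apply h1.1|by apply h2.1|].
  apply/eqP; rewrite -subr_eq0 -normr_le0.
  apply: (intF_solutions_dist beta0 hmu hnu erefl mE m0' t bphi bphi h1 h2 _ xyS).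
  move=> z _; rewrite /dW; under eq_Rintegral do rewrite subrr normr0.
  by rewrite Rintegral_cst// mul0r.
have e2 : 0 < e / 2 by rewrite divr_gt0.
(* The tolerance of [dW_small] serves as [delta]: [d_infty] bounds the gap of the [intF] values at
   every [t] and every point of [S] at once. *)
have [ts [d d0 Hd]] := dW_small e2; exists d => // phi bphi dphi G G0 hG hG0.
apply: (@le_lt_trans _ _ (e / 2)); last by rewrite ltr_pdivrMr// ltr_pMr// ltr1n.
apply: dC_le => [|x y xyS]; first exact: ltW.
apply/ltW/Hd => [||t _]; [by apply hG.1|by apply hG0.1|].
apply: (intF_solutions_dist beta0 hmu hnu erefl mE m0' t bphi bphi0 hG hG0 _ xyS).
by move=> z z01; exact: le_trans (dW_le_d_infty phi phi0 z01) (ltW dphi).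
Qed.
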